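(* Let $X$ be a separable Hilbert space, $N\ge1$, $\Lambda$ a lacunary set of nonnegative integers, and $f\in H^2_\Lambda(\mathbb{D},X)$ with $(\hat f(k))_{k\ge0}$ completely relatively compact in $X$. The following are equivalent: (i) $f$ is cyclic for $S^{*N}$ in $H^2(\mathbb{D},X)$; (ii) for every $m\ge0$, the closed linear span in $X^N$ of $\{(\hat f(Nk),\hat f(Nk+1),\dots,\hat f(Nk+N-1)) : k\ge m\}$ equals $X^N$.
   Context: $H^2(\mathbb{D},X)$: $X$-valued power series with square-summable coefficient norms; $H^2_\Lambda$ those with spectrum $\{k:\hat f(k)\neq0\}\subset\Lambda$. $\Lambda=\{n_1<n_2<\dots\}$ lacunary: $n_{k+1}/n_k\ge d>1$. $f$ is cyclic for $S^{*N}$ if the closed span of $\{S^{*Nk}f:k\ge0\}$ is $H^2(\mathbb{D},X)$, where $S^*$ is the backward shift. Completely relatively compact: for every orthogonal projection $P$ on $X$, $(P a_k/\|Pa_k\|)_{Pa_k\ne0}$ is relatively compact. *)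

(* Defs.v *)
From Stdlib Require Import Reals List.
Import ListNotations.
Open Scope R_scope.

Record Cx := mkCx { re : R; im : R }.
Definition Cadd (a b : Cx) : Cx := mkCx (re a + re b) (im a + im b).
Definition Cmul (a b : Cx) : Cx :=
  mkCx (re a * re b - im a * im b) (re a * im b + im a * re b).
Definition Cconj (a : Cx) : Cx := mkCx (re a) (- im a).
Definition C0 : Cx := mkCx 0 0.
Definition C1 : Cx := mkCx 1 0.
Definition RtoC (r : R) : Cx := mkCx r 0.

Record CHilbert := {
  hcar :> Type;
  hzero : hcar;
  hadd : hcar -> hcar -> hcar;
  hopp : hcar -> hcar;
  hscal : Cx -> hcar -> hcar;
  hinner : hcar -> hcar -> Cx;
  hadd_assoc : forall x y z, hadd x (hadd y z) = hadd (hadd x y) z;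
  hadd_comm : forall x y, hadd x y = hadd y x;
  hadd_zero : forall x, hadd x hzero = x;
  hadd_opp : forall x, hadd x (hopp x) = hzero;
  hscal_addv : forall c x y, hscal c (hadd x y) = hadd (hscal c x) (hscal c y);
  hscal_adds : forall c d x, hscal (Cadd c d) x = hadd (hscal c x) (hscal d x);
  hscal_mul : forall c d x, hscal (Cmul c d) x = hscal c (hscal d x);
  hscal_one : forall x, hscal C1 x = x;
  hinner_add : forall x y z, hinner (hadd x y) z = Cadd (hinner x z) (hinner y z);
  hinner_scal : forall c x y, hinner (hscal c x) y = Cmul c (hinner x y);
  hinner_sym : forall x y, hinner y x = Cconj (hinner x y);
  hinner_pos : forall x, 0 <= re (hinner x x);
  hinner_def : forall x, hinner x x = C0 -> x = hzero;
  hcomplete : forall u : nat -> hcar,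
    (forall eps, eps > 0 -> exists n0, forall n m, (n0 <= n)%nat -> (n0 <= m)%nat ->
       sqrt (re (hinner (hadd (u n) (hopp (u m))) (hadd (u n) (hopp (u m))))) < eps) ->
    exists l, forall eps, eps > 0 -> exists n0, forall n, (n0 <= n)%nat ->
       sqrt (re (hinner (hadd (u n) (hopp l)) (hadd (u n) (hopp l)))) < eps
}.

Section HilbertOps.
Variable X : CHilbert.

Definition hsub (x y : X) : X := hadd X x (hopp X y).
Definition hnorm (x : X) : R := sqrt (re (hinner X x x)).

Definition separable : Prop :=
  exists d : nat -> X, forall x eps, eps > 0 -> exists n, hnorm (hsub x (d n)) < eps.

Definition hconv (u : nat -> X) (l : X) : Prop :=
  forall eps, eps > 0 -> exists n0, forall n, (n0 <= n)%nat -> hnorm (hsub (u n) l) < eps.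

Definition rel_compact_family (D : nat -> Prop) (v : nat -> X) : Prop :=
  forall s : nat -> nat, (forall j, D (s j)) ->
    exists (phi : nat -> nat) (l : X),
      (forall j, (phi j < phi (S j))%nat) /\ hconv (fun j => v (s (phi j))) l.

Definition orth_proj (P : X -> X) : Prop :=
  (forall x y, P (hadd X x y) = hadd X (P x) (P y)) /\
  (forall c x, P (hscal X c x) = hscal X c (P x)) /\
  (forall x, P (P x) = P x) /\
  (forall x y, hinner X (P x) y = hinner X x (P y)).

Definition completely_rel_compact (a : nat -> X) : Prop :=
  forall P : X -> X, orth_proj P ->
    rel_compact_family (fun k => P (a k) <> hzero X)
      (fun k => hscal X (RtoC (/ hnorm (P (a k)))) (P (a k))).

Definition lincomb (l : list (Cx * nat)) (v : nat -> X) : X :=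
  fold_right (fun p acc => hadd X (hscal X (fst p) (v (snd p))) acc) (hzero X) l.

(* ---------- vector-valued Hardy space H^2(D,X) ----------
   An element f of H^2(D,X) is identified with its Taylor coefficient
   sequence (f^(k))_k : nat -> X, the H^2 norm being the l^2 norm. *)
Definition in_H2 (f : nat -> X) : Prop :=
  exists s, infinite_sum (fun k => hnorm (f k) ^ 2) s.

Definition in_H2_Lambda (Lam : nat -> Prop) (f : nat -> X) : Prop :=
  in_H2 f /\ forall k, f k <> hzero X -> Lam k.

Definition H2_dist2_lt (g h : nat -> X) (eps : R) : Prop :=
  exists s, infinite_sum (fun n => hnorm (hsub (g n) (h n)) ^ 2) s /\ s < eps.

Definition bshift (f : nat -> X) : nat -> X := fun n => f (S n).
Definition bshift_pow (j : nat) (f : nat -> X) : nat -> X := fun n => f (n + j)%nat.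

Definition cyclic_bshiftN (N : nat) (f : nat -> X) : Prop :=
  forall g, in_H2 g -> forall eps, eps > 0 ->
    exists l : list (Cx * nat),
      H2_dist2_lt g (fun n => lincomb l (fun k => bshift_pow (N * k) f n)) eps.

Definition fsum (N : nat) (u : nat -> R) : R := fold_right Rplus 0 (map u (seq 0 N)).

(* closed linear span in X^N (product Hilbert norm) of the blocks
   (f^(Nk), ..., f^(Nk+N-1)), k >= m, is all of X^N.
   An element of X^N is y : nat -> X restricted to the indices 0..N-1. *)
Definition blocks_span_dense (N m : nat) (f : nat -> X) : Prop :=
  forall y : nat -> X, forall eps, eps > 0 ->
    exists l : list (Cx * nat),
      Forall (fun p => (m <= snd p)%nat) l /\
      fsum N (fun i => hnorm (hsub (y i) (lincomb l (fun k => f (N * k + i)%nat))) ^ 2) < eps.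

End HilbertOps.

Definition lacunary (Lam : nat -> Prop) : Prop :=
  exists (n : nat -> nat) (d : R),
    d > 1 /\
    (forall k, (n k < n (S k))%nat) /\
    (forall k, INR (n (S k)) >= d * INR (n k)) /\
    (forall j, Lam j <-> exists k, n k = j).

(* Main.v *)
Require Import Defs.
From Stdlib Require Import Reals List Lra Lia Classical ClassicalEpsilon.
From Coquelicot Require Import Rbar Lim_seq Hierarchy Series.
Open Scope R_scope.

(** Applied to functions supported on a single block, cyclicity gives density
    of the blocks.

    For the converse let [g] in H^2 be orthogonal to all [S^{*Nk} f] and let
    [n_0 < n_1 < ...] enumerate [Lam]. For [m = n_j mod N], [m] bounded and [j]
    large, the gaps of [Lam] leave in the orthogonality relation at [S^{*(n_j - m)}] only
      <f(n_j), g(m)> = - sum_{i > j} <f(n_i), g(m + n_i - n_j)>,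
    where every [f(n_i)] may be replaced by its projection [b_i] onto the closed
    span of the [g(x)], [x = n_i mod N]. Relative compactness of the normalised
    projections bounds [|b_j|^2] by finitely many [|<f(n_j), g(m)>|^2], so by
    Cauchy-Schwarz
      sum_{j >= J} |b_j|^2 <= C (sum_{i >= J} |b_i|^2)
                                (sum_{m < Q} sum_{i > j >= J} |g(m + n_i - n_j)|^2).
    A given integer is a difference [n_i - n_j] boundedly often, so the last
    factor tends to 0 as [J] grows, which forces [b_j = 0] for [j >= J]. Hence
    the blocks of [g] are orthogonal to all late blocks of [f], and [g = 0]. *)

(** * Finite sums and nonnegative series *)

Lemma fsum_S n u : fsum (S n) u = fsum n u + u n.
Proof.
  unfold fsum; rewrite seq_S, map_app, fold_right_app; simpl.
  generalize (map u (seq 0 n)); intros l; induction l as [|x l IH]; simpl; lra.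
Qed.

Lemma fsum_ext n u v : (forall k, (k < n)%nat -> u k = v k) -> fsum n u = fsum n v.
Proof.
  induction n as [|n IH]; intros H; [reflexivity|].
  rewrite !fsum_S, (H n), IH; auto.
Qed.

Lemma fsum_le n u v : (forall k, (k < n)%nat -> u k <= v k) -> fsum n u <= fsum n v.
Proof.
  induction n as [|n IH]; intros H; [apply Rle_refl|].
  rewrite !fsum_S; apply Rplus_le_compat; auto.
Qed.

Lemma fsum_0 n u : (forall k, (k < n)%nat -> u k = 0) -> fsum n u = 0.
Proof.
  induction n as [|n IH]; intros H; [reflexivity|].
  rewrite fsum_S, (H n), IH; auto; lra.
Qed.

Lemma fsum_nonneg n u : (forall k, 0 <= u k) -> 0 <= fsum n u.
Proof.
  intros H; rewrite <- (fsum_0 n (fun _ => 0)) by auto; apply fsum_le; auto.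
Qed.

Lemma fsum_plus n u v : fsum n (fun k => u k + v k) = fsum n u + fsum n v.
Proof. induction n as [|n IH]; rewrite ?fsum_S, ?IH; unfold fsum; simpl; lra. Qed.

Lemma fsum_scal n a u : fsum n (fun k => a * u k) = a * fsum n u.
Proof. induction n as [|n IH]; rewrite ?fsum_S, ?IH; unfold fsum; simpl; lra. Qed.

Lemma fsum_const n a : fsum n (fun _ => a) = INR n * a.
Proof. induction n as [|n IH]; rewrite ?fsum_S, ?IH, ?S_INR; unfold fsum; simpl; lra. Qed.

Lemma fsum_add p n u : fsum (p + n) u = fsum p u + fsum n (fun k => u (p + k)%nat).
Proof.
  induction n as [|n IH].
  - rewrite Nat.add_0_r; unfold fsum; simpl; lra.
  - rewrite Nat.add_succ_r, !fsum_S, IH; lra.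
Qed.

Lemma fsum_mono n p u : (forall k, 0 <= u k) -> (n <= p)%nat -> fsum n u <= fsum p u.
Proof.
  intros Hu H; replace p with (n + (p - n))%nat by lia; rewrite fsum_add.
  pose proof (fsum_nonneg (p - n) (fun k => u (n + k)%nat) (fun k => Hu _)); lra.
Qed.

Lemma fsum_ge_term n u k : (forall k, 0 <= u k) -> (k < n)%nat -> u k <= fsum n u.
Proof.
  intros Hu H; apply Rle_trans with (fsum (S k) u); [|apply fsum_mono; auto].
  rewrite fsum_S; pose proof (fsum_nonneg k u Hu); lra.
Qed.

Lemma fsum_swap n p (u : nat -> nat -> R) :
  fsum n (fun i => fsum p (fun j => u i j)) = fsum p (fun j => fsum n (fun i => u i j)).
Proof.
  induction n as [|n IH].
  - symmetry; apply fsum_0; reflexivity.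
  - rewrite fsum_S, IH, <- fsum_plus; apply fsum_ext; intros; now rewrite fsum_S.
Qed.

Lemma fsum_if n i u : (i <= n)%nat ->
  fsum n (fun j => if (j <? i)%nat then u j else 0) = fsum i u.
Proof.
  intros H; replace n with (i + (n - i))%nat by lia; rewrite fsum_add.
  rewrite (fsum_0 (n - i)), Rplus_0_r.
  - apply fsum_ext; intros k Hk; now rewrite (proj2 (Nat.ltb_lt k i) Hk).
  - intros k _; now rewrite (proj2 (Nat.ltb_ge (i + k) i)) by lia.
Qed.

(** Strictly between consecutive values of [t] the sequence [u] vanishes, so raising [L] by one adds
    a single term on both sides. This turns sums over all coefficients into sums along the
    spectrum. *)
Lemma fsum_subseq (t : nat -> nat) u : (forall i, (t i < t (S i))%nat) ->
  (forall x, u x <> 0 -> exists i, t i = x) ->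
  forall L, fsum (S (t L)) u = fsum (S L) (fun i => u (t i)).
Proof.
  intros Ht Hu.
  assert (Hm : forall i j, (i < j)%nat -> (t i < t j)%nat).
  { intros i j H; induction H; [apply Ht|]; specialize (Ht m); lia. }
  assert (Hz : forall x, ~ (exists i, t i = x) -> u x = 0).
  { intros x Hx; destruct (Req_dec (u x) 0) as [|H]; auto; destruct Hx; auto. }
  induction L as [|L IH].
  - rewrite !fsum_S, fsum_0; [reflexivity|].
    intros k Hk; apply Hz; intros [i Hi].
    destruct i as [|i]; [lia|specialize (Hm 0%nat (S i)); lia].
  - rewrite (fsum_S (S L)), <- IH, fsum_S; f_equal.
    replace (t (S L)) with (S (t L) + (t (S L) - S (t L)))%nat by (specialize (Ht L); lia).
    rewrite fsum_add, (fsum_0 (_ - _)); [lra|].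
    intros k Hk; apply Hz; intros [i Hi].
    destruct (Nat.lt_total i (S L)) as [H|[->|H]]; [|lia|specialize (Hm (S L) i H); lia].
    destruct (Nat.eq_dec i L) as [->|H']; [lia|specialize (Hm i L); lia].
Qed.

(** [sum_n u n] includes the index [n] while [fsum n u] stops before it, hence the shift by one. *)
Lemma is_series_fsum (u : nat -> R) (l : R) : is_series u l <-> is_lim_seq (fun n => fsum n u) l.
Proof.
  rewrite (is_lim_seq_incr_1 (fun n => fsum n u)).
  assert (H : forall n, sum_n u n = fsum (S n) u).
  { induction n as [|n IH].
    - rewrite sum_O, fsum_S; unfold fsum; simpl; lra.
    - now rewrite sum_Sn, IH, (fsum_S (S n)). }
  split; intros Hl.
  - exact (is_lim_seq_ext (sum_n u) (fun n => fsum (S n) u) l H Hl).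
  - exact (is_lim_seq_ext (fun n => fsum (S n) u) (sum_n u) l (fun n => eq_sym (H n)) Hl).
Qed.

Lemma fsum_le_Series (u : nat -> R) : (forall k, 0 <= u k) -> ex_series u -> forall n, fsum n u <= Series u.
Proof.
  intros Hu Hs n; apply Series_correct, is_series_fsum in Hs.
  refine (is_lim_seq_le_loc (fun _ => fsum n u) _ (fsum n u) _ _ (is_lim_seq_const _) Hs).
  exists n; intros; now apply fsum_mono.
Qed.

Lemma Series_bounded (u : nat -> R) (M : R) : (forall k, 0 <= u k) -> (forall n, fsum n u <= M) ->
  ex_series u /\ Series u <= M.
Proof.
  intros Hu HM.
  destruct (ex_finite_lim_seq_incr (fun n => fsum n u) M) as [l Hl]; auto.
  { intros n; apply fsum_mono; auto. }
  assert (Hs : is_series u l) by now apply is_series_fsum.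
  split; [now exists l|].
  rewrite (is_series_unique _ _ Hs).
  exact (is_lim_seq_le (fun n => fsum n u) (fun _ => M) l M HM Hl (is_lim_seq_const _)).
Qed.

Lemma fsum_tail_small (u : nat -> R) : (forall k, 0 <= u k) -> ex_series u -> forall eps, 0 < eps ->
  exists n0, forall n, fsum n (fun k => u (n0 + k)%nat) <= eps.
Proof.
  intros Hu Hs eps He; pose proof (fsum_le_Series u Hu Hs) as Hle.
  apply Series_correct, is_series_fsum, is_lim_seq_spec in Hs.
  destruct (Hs (mkposreal eps He)) as [n0 Hn]; exists n0; intros n.
  specialize (Hn n0 (le_n _)); specialize (Hle (n0 + n)%nat).
  rewrite fsum_add in Hle; apply Rabs_def2 in Hn; simpl in Hn; lra.
Qed.

Lemma is_lim_seq_fsum p (u : nat -> nat -> R) (l : nat -> R) :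
  (forall j, (j < p)%nat -> is_lim_seq (fun n => u n j) (l j)) ->
  is_lim_seq (fun n => fsum p (u n)) (fsum p l).
Proof.
  induction p as [|p IH]; intros H; [apply is_lim_seq_const|].
  apply (is_lim_seq_ext (fun n => fsum p (u n) + u n p)); [intros; now rewrite fsum_S|].
  rewrite fsum_S; apply is_lim_seq_plus'; auto.
Qed.

(** For nonzero [c] take the minimiser [t = - b / c]; for [c = 0] the expression is affine in [t]
    and becomes negative somewhere unless [b = 0]. The Cauchy-Schwarz inequalities and the
    orthogonality in [projection] come from here. *)
Lemma discriminant_le a b c : 0 <= c -> (forall t, 0 <= a + 2 * t * b + t * t * c) ->
  b * b <= a * c.
Proof.
  intros Hc H; destruct (Req_dec c 0) as [->|H0].
  - destruct (Req_dec b 0) as [->|Hb]; [lra|].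
    specialize (H (- (a + 1) / (2 * b))).
    replace (2 * (- (a + 1) / (2 * b)) * b) with (- (a + 1)) in H by (field; auto); lra.
  - specialize (H (- b / c)).
    replace (a + 2 * (- b / c) * b + - b / c * (- b / c) * c) with ((a * c - b * b) / c) in H
      by (field; auto).
    apply Rmult_le_compat_r with (r := c) in H; [|lra].
    unfold Rdiv in H; rewrite Rmult_assoc, Rinv_l in H by auto; lra.
Qed.

(** * Projection in a complete real semi-inner-product space *)

(* No vector space axioms are required: every identity that is needed is
   an identity between values of the bilinear form. *)
Record SemiHilbert := {
  scar :> Type;
  sadd : scar -> scar -> scar;
  sscal : R -> scar -> scar;
  sip : scar -> scar -> R;
  sip_addl : forall x y z, sip (sadd x y) z = sip x z + sip y z;
  sip_scall : forall a x y, sip (sscal a x) y = a * sip x y;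
  sip_sym : forall x y, sip x y = sip y x;
  sip_pos : forall x, 0 <= sip x x;
  scomplete : forall u : nat -> scar,
    (forall eps, 0 < eps -> exists n0, forall n m, (n0 <= n)%nat -> (n0 <= m)%nat ->
       sip (sadd (u n) (sscal (-1) (u m))) (sadd (u n) (sscal (-1) (u m))) < eps) ->
    exists l, forall eps, 0 < eps -> exists n0, forall n, (n0 <= n)%nat ->
       sip (sadd (u n) (sscal (-1) l)) (sadd (u n) (sscal (-1) l)) < eps
}.
Arguments sadd {_}. Arguments sscal {_}. Arguments sip {_}.

Definition ssub {H : SemiHilbert} (x y : H) : H := sadd x (sscal (-1) y).

Section Projection.
Variable H : SemiHilbert.
Implicit Types x y z v : H.

Lemma sip_addr x y z : sip z (sadd x y) = sip z x + sip z y.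
Proof. now rewrite sip_sym, sip_addl, !(sip_sym H z). Qed.

Lemma sip_scalr a x y : sip y (sscal a x) = a * sip y x.
Proof. now rewrite sip_sym, sip_scall, (sip_sym H y). Qed.

Lemma sip_subl x y z : sip (ssub x y) z = sip x z - sip y z.
Proof. unfold ssub; rewrite sip_addl, sip_scall; lra. Qed.

Lemma sip_subr x y z : sip z (ssub x y) = sip z x - sip z y.
Proof. unfold ssub; rewrite sip_addr, sip_scalr; lra. Qed.

Lemma sip_CauchySchwarz x y : sip x y * sip x y <= sip x x * sip y y.
Proof.
  apply discriminant_le; [apply sip_pos|]; intros t.
  pose proof (sip_pos H (sadd x (sscal t y))) as P.
  rewrite !sip_addl, !sip_addr, !sip_scall, !sip_scalr, (sip_sym H y x) in P; lra.
Qed.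

Lemma sip_add_sqr_le x y : sip (sadd x y) (sadd x y) <= 2 * sip x x + 2 * sip y y.
Proof.
  pose proof (sip_pos H (ssub x y)) as P.
  rewrite !sip_subl, !sip_subr in P; rewrite !sip_addl, !sip_addr.
  pose proof (sip_sym H x y); lra.
Qed.

Lemma sip_sub_sqr_le x y : sip (ssub x y) (ssub x y) <= 2 * sip x x + 2 * sip y y.
Proof.
  pose proof (sip_pos H (sadd x y)) as P.
  rewrite !sip_addl, !sip_addr in P; rewrite !sip_subl, !sip_subr.
  pose proof (sip_sym H x y); lra.
Qed.

Lemma fsum_CauchySchwarz n (x y : nat -> H) :
  fsum n (fun i => sip (x i) (y i)) * fsum n (fun i => sip (x i) (y i)) <=
  fsum n (fun i => sip (x i) (x i)) * fsum n (fun i => sip (y i) (y i)).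
Proof.
  apply discriminant_le; [apply fsum_nonneg; intros; apply sip_pos|]; intros t.
  rewrite <- !fsum_scal, <- !fsum_plus; apply fsum_nonneg; intros i.
  pose proof (sip_pos H (sadd (x i) (sscal t (y i)))) as P.
  rewrite !sip_addl, !sip_addr, !sip_scall, !sip_scalr, (sip_sym H (y i) (x i)) in P; lra.
Qed.

Lemma inv_nat_small eps : 0 < eps -> exists n0, forall n, (n0 <= n)%nat -> / INR (S n) < eps.
Proof.
  intros He; destruct (archimed_cor1 eps He) as [N [HN HN0]]; exists N; intros n Hn.
  apply Rle_lt_trans with (/ INR N); auto.
  apply Rinv_le_contravar; [now apply lt_0_INR|apply le_INR; lia].
Qed.

(** A minimising sequence for the distance from [x] to [V] is Cauchy by the parallelogram law. [V]
    is not assumed closed, so its limit [p] is only described as approximable from [V]. *)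
Theorem projection (V : H -> Prop) (x : H) :
  (exists v, V v) -> (forall u v, V u -> V v -> V (sadd u v)) ->
  (forall a v, V v -> V (sscal a v)) ->
  exists p, (forall eps, 0 < eps -> exists v, V v /\ sip (ssub p v) (ssub p v) < eps) /\
    forall v, V v -> sip (ssub x p) v = 0.
Proof.
  intros [v0 Hv0] Vadd Vscal.
  (* [completeness] yields suprema, so squared distances are negated: [- s] is the squared distance
     from [x] to [V]. *)
  set (E := fun s => exists v, V v /\ s = - sip (ssub x v) (ssub x v)).
  destruct (completeness E) as [s [Hub Hlub]].
  { exists 0; intros s [v [_ ->]]; pose proof (sip_pos H (ssub x v)); lra. }
  { now exists (- sip (ssub x v0) (ssub x v0)), v0. }
  assert (Hd : forall v, V v -> - s <= sip (ssub x v) (ssub x v)).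
  { intros v Hv; enough (- sip (ssub x v) (ssub x v) <= s) by lra; apply Hub; now exists v. }
  assert (Hn : forall n, exists v, V v /\ sip (ssub x v) (ssub x v) < - s + / INR (S n)).
  { intros n; apply NNPP; intros Hno.
    assert (0 < / INR (S n)) by (apply Rinv_0_lt_compat, lt_0_INR; lia).
    enough (s <= s - / INR (S n)) by lra.
    apply Hlub; intros r [v [Hv ->]].
    apply Rnot_lt_le; intros Hlt; apply Hno; exists v; split; auto; lra. }
  apply choice in Hn; destruct Hn as [w Hw].
  destruct (scomplete H w) as [p Hp].
  (* The midpoint of [w n] and [w m] lies in [V], so the parallelogram law bounds the squared
     distance between them by [2 / INR (S n) + 2 / INR (S m)]. *)
  { intros eps He; destruct (inv_nat_small (eps / 4)) as [n0 Hn0]; [lra|].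
    exists n0; intros n m Hn Hm.
    destruct (Hw n) as [Vn Wn], (Hw m) as [Vm Wm].
    pose proof (Hd _ (Vscal (/ 2) _ (Vadd _ _ Vn Vm))) as D.
    specialize (Hn0 n Hn) as In; specialize (Hn0 m Hm) as Im.
    fold (ssub (w n) (w m)).
    rewrite !sip_subl, !sip_subr, ?sip_scall, ?sip_scalr, ?sip_addl, ?sip_addr,
      ?sip_scall, ?sip_scalr, ?sip_addl, ?sip_addr in *.
    pose proof (sip_sym H x (w n)); pose proof (sip_sym H x (w m));
    pose proof (sip_sym H (w m) (w n)); lra. }
  exists p; split.
  { intros eps He; destruct (Hp eps He) as [n0 Hn0]; exists (w n0); split; [apply Hw|].
    specialize (Hn0 n0 (le_n _)); fold (ssub (w n0) p) in Hn0.
    rewrite !sip_subl, !sip_subr in *; lra. }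
  intros v Hv; apply Rsqr_0_uniq, Rle_antisym; [|apply Rle_0_sqr].
  apply le_epsilon; intros eps He; rewrite Rplus_0_l; unfold Rsqr.
  set (c := sip v v).
  assert (Hc : 0 <= c) by apply sip_pos.
  (* Chosen so that [(a + b)^2 <= 2 a^2 + 2 b^2 <= 4 e c <= eps] for the splitting [a + b] made
     below. *)
  set (e := eps / (4 * (c + 1))).
  assert (He' : 0 < e) by (apply Rdiv_lt_0_compat; lra).
  destruct (Hp e He') as [n0 Hn0], (inv_nat_small e He') as [n1 Hn1].
  set (n := (n0 + n1)%nat); specialize (Hn0 n ltac:(lia)); specialize (Hn1 n ltac:(lia)).
  fold (ssub (w n) p) in Hn0; destruct (Hw n) as [Vn Wn].
  set (a := sip (ssub x (w n)) v); set (b := sip (ssub (w n) p) v).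
  (* Replacing [w n] by [w n + t v] stays in [V] and lowers the squared distance by at most
     [/ INR (S n)]; the discriminant of this quadratic in [t] controls [a]. *)
  assert (Ha : (- a) * (- a) <= / INR (S n) * c).
  { apply discriminant_le; auto; intros t.
    pose proof (Hd _ (Vadd _ _ Vn (Vscal t _ Hv))) as D.
    unfold a, c.
    rewrite !sip_subl, !sip_subr, ?sip_addl, ?sip_addr, ?sip_scall, ?sip_scalr in *.
    pose proof (sip_sym H x (w n)); pose proof (sip_sym H x v); pose proof (sip_sym H v (w n)).
    nra. }
  pose proof (sip_CauchySchwarz (ssub (w n) p) v) as Hb; fold b c in Hb.
  replace (sip (ssub x p) v) with (a + b) by (unfold a, b; rewrite !sip_subl; lra).
  assert (Hec : e * (4 * (c + 1)) = eps) by (unfold e; field; lra).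
  assert (/ INR (S n) * c <= e * c) by (apply Rmult_le_compat_r; lra).
  assert (sip (ssub (w n) p) (ssub (w n) p) * c <= e * c) by (apply Rmult_le_compat_r; lra).
  nra.
Qed.

End Projection.

(** * Square-summable sequences *)

Section SquareSummable.
Variable H : SemiHilbert.

Definition sqsum (f : nat -> H) : Prop := ex_series (fun k => sip (f k) (f k)).

Lemma ex_series_dominated (u v : nat -> R) :
  (forall k, Rabs (u k) <= v k) -> ex_series v -> ex_series u.
Proof. exact (@ex_series_le R_AbsRing R_CompleteNormedModule u v). Qed.

Lemma sqsum_dominated (h f g : nat -> H) :
  (forall k, sip (h k) (h k) <= 2 * sip (f k) (f k) + 2 * sip (g k) (g k)) ->
  sqsum f -> sqsum g -> sqsum h.
Proof.
  intros Hh Hf Hg.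
  apply ex_series_dominated
    with (fun k => plus (scal 2 (sip (f k) (f k))) (scal 2 (sip (g k) (g k)))).
  - intros k; rewrite Rabs_pos_eq by apply sip_pos; apply Hh.
  - apply (@ex_series_plus R_AbsRing R_NormedModule);
      now apply (@ex_series_scal_l R_AbsRing).
Qed.

Lemma sqsum_add f g : sqsum f -> sqsum g -> sqsum (fun k => sadd (f k) (g k)).
Proof. apply sqsum_dominated; intros; apply sip_add_sqr_le. Qed.

Lemma sqsum_scal a f : sqsum f -> sqsum (fun k => sscal a (f k)).
Proof.
  intros Hf; apply ex_series_ext with (fun k => (a * a) * sip (f k) (f k)).
  - intros k; rewrite sip_scall, sip_scalr; apply Rmult_assoc.
  - now apply (@ex_series_scal_l R_AbsRing).
Qed.

Lemma ex_series_sip f g : sqsum f -> sqsum g -> ex_series (fun k => sip (f k) (g k)).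
Proof.
  intros Hf Hg.
  apply ex_series_dominated with (fun k => plus (sip (f k) (f k)) (sip (g k) (g k))).
  - intros k; pose proof (sip_sym H (f k) (g k)); unfold plus; simpl.
    pose proof (sip_pos H (f k)); pose proof (sip_pos H (g k)).
    pose proof (sip_pos H (sadd (f k) (g k))) as P; pose proof (sip_pos H (ssub (f k) (g k))) as M.
    rewrite sip_addl, !sip_addr in P; rewrite sip_subl, !sip_subr in M.
    apply Rabs_le; lra.
  - now apply (@ex_series_plus R_AbsRing R_NormedModule).
Qed.

Let T := {f : nat -> H | sqsum f}.
Let ladd (f g : T) : T :=
  exist _ _ (sqsum_add _ _ (proj2_sig f) (proj2_sig g)).
Let lscal (a : R) (f : T) : T := exist _ _ (sqsum_scal a _ (proj2_sig f)).
Let lip (f g : T) : R := Series (fun k => sip (proj1_sig f k) (proj1_sig g k)).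

(** Each coordinate converges by completeness of [H]. The Cauchy estimate is kept on finite partial
    sums, uniformly in their length, so the limit passes through finitely many coordinates at a
    time. *)
Lemma l2_complete (u : nat -> T) :
  (forall eps, 0 < eps -> exists n0, forall n m, (n0 <= n)%nat -> (n0 <= m)%nat ->
     lip (ladd (u n) (lscal (-1) (u m))) (ladd (u n) (lscal (-1) (u m))) < eps) ->
  exists l, forall eps, 0 < eps -> exists n0, forall n, (n0 <= n)%nat ->
     lip (ladd (u n) (lscal (-1) l)) (ladd (u n) (lscal (-1) l)) < eps.
Proof.
  intros HC.
  pose (d := fun n m k => sip (ssub (proj1_sig (u n) k) (proj1_sig (u m) k))
                              (ssub (proj1_sig (u n) k) (proj1_sig (u m) k))).
  assert (HCp : forall eps, 0 < eps -> exists n0, forall n m, (n0 <= n)%nat -> (n0 <= m)%nat ->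
     forall K, fsum K (d n m) < eps).
  { intros eps He; destruct (HC eps He) as [n0 Hn0]; exists n0; intros n m Hn Hm K.
    refine (Rle_lt_trans _ _ _ _ (Hn0 n m Hn Hm)).
    apply (fsum_le_Series (d n m)); [intros; apply sip_pos|].
    exact (proj2_sig (ladd (u n) (lscal (-1) (u m)))). }
  assert (HL : forall k, exists l, forall eps, 0 < eps -> exists n0, forall n, (n0 <= n)%nat ->
     sip (ssub (proj1_sig (u n) k) l) (ssub (proj1_sig (u n) k) l) < eps).
  { intros k; apply (scomplete H (fun n => proj1_sig (u n) k)); intros eps He.
    destruct (HCp eps He) as [n0 Hn0]; exists n0; intros n m Hn Hm.
    refine (Rle_lt_trans _ _ _ _ (Hn0 n m Hn Hm (S k))).
    apply (fsum_ge_term (S k) (d n m) k); [intros; apply sip_pos|lia]. }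
  apply choice in HL; destruct HL as [l Hl].
  pose (e := fun n k => sip (ssub (proj1_sig (u n) k) (l k)) (ssub (proj1_sig (u n) k) (l k))).
  (* Here [n0] does not depend on [K], whereas the auxiliary index at which [u] is close to [l] on
     the first [K] coordinates may. *)
  assert (He : forall eps, 0 < eps -> exists n0, forall n, (n0 <= n)%nat ->
     forall K, fsum K (e n) <= eps / 2).
  { intros eps He; destruct (HCp (eps / 8)) as [n0 Hn0]; [lra|].
    exists n0; intros n Hn K.
    assert (Hlim : is_lim_seq (fun m => fsum K (e m)) (fsum K (fun _ => 0))).
    { apply is_lim_seq_fsum; intros k _; apply is_lim_seq_spec; intros [r Hr].
      destruct (Hl k r Hr) as [m0 Hm0]; exists m0; intros m Hm; simpl.
      rewrite Rminus_0_r, Rabs_pos_eq by apply sip_pos; now apply Hm0. }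
    rewrite fsum_0 in Hlim by auto; apply is_lim_seq_spec in Hlim.
    destruct (Hlim (mkposreal (eps / 8) ltac:(lra))) as [m0 Hm0].
    specialize (Hm0 (m0 + n0)%nat ltac:(lia)); simpl in Hm0; apply Rabs_def2 in Hm0.
    specialize (Hn0 n (m0 + n0)%nat Hn ltac:(lia) K).
    apply Rle_trans with (fsum K (fun k => 2 * d n (m0 + n0)%nat k + 2 * e (m0 + n0)%nat k)).
    - apply fsum_le; intros k _; unfold d, e.
      set (x := proj1_sig (u n) k); set (y := proj1_sig (u (m0 + n0)%nat) k).
      pose proof (sip_add_sqr_le H (ssub x y) (ssub y (l k))) as P.
      rewrite !sip_addl, !sip_addr, !sip_subl, !sip_subr in P.
      rewrite !sip_subl, !sip_subr; lra.
    - rewrite fsum_plus, !fsum_scal; lra. }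
  (* Square summability of [l] comes from writing it as [u n - (u n - l)]. *)
  assert (Hsq : forall n, (forall K, fsum K (e n) <= 1 / 2) -> sqsum l).
  { intros n Hn; apply (sqsum_dominated _ (proj1_sig (u n)) (fun k => ssub (proj1_sig (u n) k) (l k))).
    - intros k; set (x := proj1_sig (u n) k).
      pose proof (sip_sub_sqr_le H x (ssub x (l k))) as P.
      rewrite !sip_subl, !sip_subr in P; rewrite !sip_subl, !sip_subr.
      pose proof (sip_sym H x (l k)); lra.
    - apply (proj2_sig (u n)).
    - apply (Series_bounded (e n) (1 / 2)); auto; intros; apply sip_pos. }
  assert (Hs : sqsum l).
  { destruct (He 1 Rlt_0_1) as [n0 Hn0]; apply (Hsq n0); auto. }
  exists (exist _ l Hs); intros eps Heps; destruct (He eps Heps) as [n0 Hn0].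
  exists n0; intros n Hn.
  apply Rle_lt_trans with (eps / 2); [|lra].
  apply (Series_bounded (e n)); auto; intros; apply sip_pos.
Qed.

(** Closed with [Defined] so that later [change] steps can unfold the operations and the inner
    product. *)
Definition l2 : SemiHilbert.
Proof.
  refine (Build_SemiHilbert T ladd lscal lip _ _ _ _ l2_complete).
  - intros x y z; unfold lip; rewrite <- Series_plus.
    + apply Series_ext; intros k; apply sip_addl.
    + apply ex_series_sip; apply proj2_sig.
    + apply ex_series_sip; apply proj2_sig.
  - intros a x y; unfold lip; rewrite <- Series_scal_l.
    apply Series_ext; intros k; apply sip_scall.
  - intros x y; apply Series_ext; intros k; apply sip_sym.
  - intros x; apply Rle_trans with (fsum 0 (fun k => sip (proj1_sig x k) (proj1_sig x k)));
      [apply Rle_refl|].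
    apply fsum_le_Series; [intros; apply sip_pos|apply proj2_sig].
Defined.

End SquareSummable.

(** * The real structure of a complex Hilbert space *)

Section RealStructure.
Variable X : CHilbert.
Implicit Types x y z : X.

Lemma re_hinner_hzero y : re (hinner X (hzero X) y) = 0.
Proof.
  pose proof (f_equal re (hinner_add X (hzero X) (hzero X) y)) as P.
  rewrite hadd_zero in P; simpl in P; lra.
Qed.

Lemma re_hinner_hopp x y : re (hinner X (hopp X x) y) = - re (hinner X x y).
Proof.
  pose proof (f_equal re (hinner_add X x (hopp X x) y)) as P.
  rewrite hadd_opp, re_hinner_hzero in P; simpl in P; lra.
Qed.

Lemma re_hinner_scal_real a x y : re (hinner X (hscal X (RtoC a) x) y) = a * re (hinner X x y).
Proof. rewrite hinner_scal; simpl; lra. Qed.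

Lemma re_hinner_sym x y : re (hinner X x y) = re (hinner X y x).
Proof. now rewrite hinner_sym. Qed.

Lemma re_hinner_sub_sqr x y :
  re (hinner X (hsub X x y) (hsub X x y)) =
  re (hinner X (hadd X x (hscal X (RtoC (-1)) y)) (hadd X x (hscal X (RtoC (-1)) y))).
Proof.
  assert (P : forall z, re (hinner X (hsub X x y) z)
                        = re (hinner X (hadd X x (hscal X (RtoC (-1)) y)) z)).
  { intros z; unfold hsub; rewrite !hinner_add; simpl.
    rewrite re_hinner_hopp, re_hinner_scal_real; lra. }
  now rewrite P, re_hinner_sym, P.
Qed.

Lemma hreal_complete (u : nat -> X) :
  (forall eps, 0 < eps -> exists n0, forall n m, (n0 <= n)%nat -> (n0 <= m)%nat ->
    re (hinner X (hadd X (u n) (hscal X (RtoC (-1)) (u m)))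
                 (hadd X (u n) (hscal X (RtoC (-1)) (u m)))) < eps) ->
  exists l, forall eps, 0 < eps -> exists n0, forall n, (n0 <= n)%nat ->
    re (hinner X (hadd X (u n) (hscal X (RtoC (-1)) l))
                 (hadd X (u n) (hscal X (RtoC (-1)) l))) < eps.
Proof.
  intros HC; destruct (hcomplete X u) as [l Hl].
  - intros eps He; destruct (HC (eps * eps)) as [n0 Hn0]; [nra|].
    exists n0; intros n m Hn Hm; specialize (Hn0 n m Hn Hm).
    rewrite <- re_hinner_sub_sqr in Hn0.
    rewrite <- (sqrt_square eps) by lra.
    apply sqrt_lt_1_alt; split; [apply hinner_pos|exact Hn0].
  - exists l; intros eps He; destruct (Hl (sqrt eps)) as [n0 Hn0]; [now apply sqrt_lt_R0|].
    exists n0; intros n Hn; rewrite <- re_hinner_sub_sqr.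
    apply sqrt_lt_0_alt; exact (Hn0 n Hn).
Qed.

(** The real part of the inner product suffices for the projection theorem; complex orthogonality is
    recovered by testing against both [y] and [itimes y]. *)
Definition hreal : SemiHilbert.
Proof.
  refine (Build_SemiHilbert X (hadd X) (fun a => hscal X (RtoC a))
            (fun x y => re (hinner X x y)) _ _ re_hinner_sym (hinner_pos X) hreal_complete).
  - intros; now rewrite hinner_add.
  - apply re_hinner_scal_real.
Defined.

End RealStructure.

Canonical hreal.

Notation rip X x y := (@sip (hreal X) x y).
Notation "'itimes'" := (hscal _ (mkCx 0 1)).

Section ComplexStructure.
Variable X : CHilbert.
Implicit Types x y z : X.

Lemma rip_hadd x y z : rip X (hadd X x y) z = rip X x z + rip X y z.
Proof. exact (sip_addl (hreal X) x y z). Qed.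

Lemma rip_hsub x y z : rip X (hsub X x y) z = rip X x z - rip X y z.
Proof.
  unfold hsub; rewrite rip_hadd; simpl; rewrite re_hinner_hopp; lra.
Qed.

Lemma rip_hsub_r x y z : rip X z (hsub X x y) = rip X z x - rip X z y.
Proof. now rewrite sip_sym, rip_hsub, !(sip_sym (hreal X) z). Qed.

Lemma rip_hzero y : rip X (hzero X) y = 0.
Proof. exact (re_hinner_hzero X y). Qed.

(** Conjugate linearity in the second argument gives [<x, i y> = - i <x, y>], whose real part is the
    imaginary part of [<x, y>]. *)
Lemma im_hinner x y : im (hinner X x y) = rip X x (itimes y).
Proof. simpl; rewrite (hinner_sym X (itimes y) x), hinner_scal, (hinner_sym X x y); simpl; lra. Qed.

Lemma rip_hscal c x y : rip X (hscal X c x) y = re c * rip X x y - im c * rip X x (itimes y).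
Proof. rewrite <- im_hinner; simpl; rewrite hinner_scal; reflexivity. Qed.

Lemma rip_itimes_r x y : rip X x (itimes y) = - rip X (itimes x) y.
Proof. rewrite (rip_hscal _ x); simpl; lra. Qed.

Lemma rip_itimes_itimes x y : rip X (itimes (itimes x)) y = - rip X x y.
Proof. rewrite <- hscal_mul, rip_hscal; simpl; lra. Qed.

Lemma rip_itimes2 x y : rip X (itimes x) (itimes y) = rip X x y.
Proof. rewrite rip_itimes_r, rip_itimes_itimes; lra. Qed.

Lemma hnorm_sqr x : hnorm X x ^ 2 = rip X x x.
Proof. unfold hnorm; rewrite <- Rsqr_pow2, Rsqr_sqrt by apply hinner_pos; reflexivity. Qed.

Lemma rip_eq0 x : rip X x x = 0 -> x = hzero X.
Proof.
  intros Hx; apply hinner_def.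
  pose proof (f_equal im (hinner_sym X x x)) as P; simpl in P, Hx.
  destruct (hinner X x x) as [a b]; simpl in *; unfold C0; f_equal; lra.
Qed.

Lemma hsub_eq0 x y : hsub X x y = hzero X -> x = y.
Proof.
  intros E; rewrite <- (hadd_zero X x), <- (hadd_opp X y), (hadd_comm X y), hadd_assoc.
  unfold hsub in E; rewrite E, hadd_comm; apply hadd_zero.
Qed.

Lemma hinner_eq x y x' y' : rip X x y = rip X x' y' ->
  rip X x (itimes y) = rip X x' (itimes y') -> hinner X x y = hinner X x' y'.
Proof.
  rewrite <- !im_hinner; simpl; destruct (hinner X x y), (hinner X x' y'); simpl.
  now intros -> ->.
Qed.

End ComplexStructure.

(** * Annihilators and compactness *)

Section Annihilator.
Variable X : CHilbert.
Variable g : nat -> X.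
Variable D : nat -> bool.

(** The two real equations express one complex orthogonality, so this is the orthogonal complement
    of the selected [g m]. Later [D] selects a residue class modulo [N]. *)
Definition annih (z : X) : Prop :=
  forall m, D m = true -> rip X z (g m) = 0 /\ rip X z (itimes (g m)) = 0.

Lemma annih_hadd x y : annih x -> annih y -> annih (hadd X x y).
Proof.
  intros Hx Hy m Hm; destruct (Hx m Hm), (Hy m Hm); rewrite !rip_hadd; split; lra.
Qed.

Lemma annih_hscal c x : annih x -> annih (hscal X c x).
Proof.
  intros Hx m Hm; destruct (Hx m Hm) as [A B]; rewrite !rip_hscal, A, B.
  rewrite (sip_sym (hreal X) x), rip_itimes_itimes, sip_sym, A; split; lra.
Qed.

(** Pairing with a fixed vector is continuous by Cauchy-Schwarz. This places the limit returned by
    [projection] in the annihilator itself. *)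
Lemma annih_closed x :
  (forall eps, 0 < eps -> exists z, annih z /\ rip X (ssub x z) (ssub x z) < eps) -> annih x.
Proof.
  intros Hx.
  assert (Hy : forall y, (forall z, annih z -> rip X z y = 0) -> rip X x y = 0).
  { intros y Hy; apply Rsqr_0_uniq, Rle_antisym; [|apply Rle_0_sqr].
    apply le_epsilon; intros eps He; rewrite Rplus_0_l; unfold Rsqr.
    pose proof (sip_pos (hreal X) y) as Py.
    destruct (Hx (eps / (rip X y y + 1))) as [z [Hz Hxz]]; [apply Rdiv_lt_0_compat; lra|].
    pose proof (sip_CauchySchwarz (hreal X) (ssub x z) y) as CS.
    rewrite sip_subl, (Hy z Hz), Rminus_0_r in CS.
    assert (eps / (rip X y y + 1) * (rip X y y + 1) = eps) by (field; lra).
    pose proof (sip_pos (hreal X) (ssub x z)); nra. }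
  intros m Hm; split; apply Hy; intros z Hz; apply Hz; exact Hm.
Qed.

(** [P] projects onto the closed span of the selected [g m]. It is built as the identity minus the
    projection onto their annihilator, so closed spans need no separate treatment; its algebraic
    laws follow from uniqueness of the decomposition. *)
Lemma annihilator_projection : exists P : X -> X, orth_proj X P /\
  (forall x, annih (hsub X x (P x))) /\ (forall x z, annih z -> rip X (P x) z = 0).
Proof.
  assert (HP : forall x : X, exists p, annih (hsub X x p) /\ forall z, annih z -> rip X p z = 0).
  { intros x; destruct (projection (hreal X) annih x) as [q [Hq Hxq]].
    - exists (hzero X); intros m _; now rewrite !rip_hzero.
    - apply annih_hadd.
    - intros a v; apply annih_hscal.
    - apply annih_closed in Hq; exists (hsub X x q); split.
      + intros m Hm; destruct (Hq m Hm); rewrite !rip_hsub; split; lra.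
      + intros z Hz; specialize (Hxq z Hz); rewrite sip_subl in Hxq; rewrite rip_hsub; lra. }
  apply choice in HP; destruct HP as [P HP].
  assert (HPW : forall x z, annih z -> rip X (P x) z = 0) by (intros; now apply HP).
  assert (HPW2 : forall x z, annih z -> rip X (P x) (itimes z) = 0).
  { intros x z Hz; apply HPW, annih_hscal, Hz. }
  (* The difference [P x - p] lies in the annihilator and is orthogonal to it, hence to itself. *)
  assert (uniq : forall x p, annih (hsub X x p) -> (forall z, annih z -> rip X p z = 0) -> P x = p).
  { intros x p H1 H2; destruct (HP x) as [H3 H4].
    apply hsub_eq0, rip_eq0.
    assert (Hd : annih (hsub X (P x) p)).
    { intros m Hm; destruct (H1 m Hm) as [A1 A2], (H3 m Hm) as [B1 B2].
      rewrite !rip_hsub in *; split; lra. }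
    rewrite rip_hsub, (H2 _ Hd), (H4 _ Hd); lra. }
  exists P; split; [|split; auto; intros x; apply HP].
  split; [|split; [|split]].
  - intros x y; apply uniq.
    + intros m Hm; destruct (proj1 (HP x) m Hm) as [A1 A2], (proj1 (HP y) m Hm) as [B1 B2].
      rewrite !rip_hsub in *; rewrite !rip_hadd; split; lra.
    + intros z Hz; rewrite rip_hadd, !HPW; auto; lra.
  - intros c x; apply uniq.
    + intros m Hm; destruct (annih_hscal c _ (proj1 (HP x)) m Hm) as [A1 A2].
      rewrite !(rip_hscal X c) in A1, A2; rewrite !rip_hsub in *.
      rewrite !(rip_hscal X c); split; lra.
    + intros z Hz; rewrite rip_hscal, HPW, HPW2; auto; lra.
  - intros x; apply uniq; auto.
    intros m _; rewrite !rip_hsub; split; lra.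
  (* Since [y - P y] lies in the annihilator, [<P x, y> = <P x, P y>], an expression symmetric in
     the roles of [x] and [y]; [S2] handles the imaginary part. *)
  - assert (S : forall x y, rip X (P x) y = rip X (P x) (P y)).
    { intros x y; pose proof (HPW x _ (proj1 (HP y))) as E; rewrite rip_hsub_r in E; lra. }
    assert (S2 : forall x y, rip X (P x) (itimes y) = rip X (P x) (itimes (P y))).
    { intros x y; pose proof (HPW2 x _ (proj1 (HP y))) as E.
      rewrite rip_itimes_r, rip_hsub_r in E; rewrite !(rip_itimes_r X (P x)); lra. }
    intros x y; apply hinner_eq.
    + rewrite (sip_sym (hreal X) x), (S x y), (S y x); apply sip_sym.
    + rewrite (S2 x y), (rip_itimes_r X x), (sip_sym (hreal X) (itimes x)), (S2 y x).
      rewrite (rip_itimes_r X (P y)), Ropp_involutive; apply sip_sym.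
Qed.

(** The squared modulus of the complex inner product. *)
Definition hinner_sqr (x y : X) : R :=
  rip X x y * rip X x y + rip X x (itimes y) * rip X x (itimes y).

Lemma hinner_sqr_nonneg x y : 0 <= hinner_sqr x y.
Proof. apply Rplus_le_le_0_compat; apply Rle_0_sqr. Qed.

Lemma hinner_sqr_real_scal a x y : hinner_sqr (hscal X (RtoC a) x) y = a * a * hinner_sqr x y.
Proof. unfold hinner_sqr; rewrite !rip_hscal; simpl re; simpl im; ring. Qed.

End Annihilator.

Lemma hconv_rip (X : CHilbert) (u : nat -> X) (l : X) : hconv X u l ->
  is_lim_seq (fun n => rip X (hsub X (u n) l) (hsub X (u n) l)) 0.
Proof.
  intros H; apply is_lim_seq_spec; intros [eps He]; simpl.
  destruct (H (sqrt eps)) as [n0 Hn0]; [now apply sqrt_lt_R0|].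
  exists n0; intros n Hn; rewrite Rminus_0_r, Rabs_pos_eq by apply (sip_pos (hreal X)).
  apply sqrt_lt_0_alt, (Hn0 n Hn).
Qed.

Lemma is_lim_seq_sqr_0 (u : nat -> R) : is_lim_seq (fun n => u n * u n) 0 -> is_lim_seq u 0.
Proof.
  intros H; apply is_lim_seq_spec in H; apply is_lim_seq_spec; intros [eps He]; simpl.
  destruct (H (mkposreal (eps * eps) ltac:(simpl; nra))) as [n0 Hn0]; exists n0; intros n Hn.
  specialize (Hn0 n Hn); simpl in Hn0; rewrite Rminus_0_r in *.
  rewrite Rabs_mult in Hn0; pose proof (Rabs_pos (u n)); nra.
Qed.

Lemma hconv_rip_lim (X : CHilbert) (u : nat -> X) (l y : X) : hconv X u l ->
  is_lim_seq (fun n => rip X (u n) y) (rip X l y).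
Proof.
  intros H; apply hconv_rip in H.
  assert (H0 : is_lim_seq (fun n => rip X (hsub X (u n) l) y) 0).
  { apply is_lim_seq_sqr_0.
    apply (is_lim_seq_le_le (fun _ => 0) _
             (fun n => rip X (hsub X (u n) l) (hsub X (u n) l) * rip X y y)).
    - intros n; split; [apply Rle_0_sqr|apply sip_CauchySchwarz].
    - apply is_lim_seq_const.
    - replace (Finite 0) with (Finite (0 * rip X y y)) by (f_equal; ring).
      apply is_lim_seq_mult'; [exact H|apply is_lim_seq_const]. }
  apply (is_lim_seq_ext (fun n => rip X (hsub X (u n) l) y + rip X l y)).
  - intros n; rewrite rip_hsub; lra.
  - replace (Finite (rip X l y)) with (Finite (0 + rip X l y)) by (f_equal; ring).
    apply is_lim_seq_plus'; [exact H0|apply is_lim_seq_const].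
Qed.

(* Otherwise a limit of normalised projections would lie both in the range
   of [P] and in its kernel, although it has norm one. *)
Lemma compact_coefficient_bound (X : CHilbert) (f g : nat -> X) (D : nat -> bool) (P : X -> X) :
  orth_proj X P -> (forall x, annih X g D (hsub X x (P x))) ->
  (forall x z, annih X g D z -> rip X (P x) z = 0) ->
  rel_compact_family X (fun k => P (f k) <> hzero X)
    (fun k => hscal X (RtoC (/ hnorm X (P (f k)))) (P (f k))) ->
  exists Q, forall k, rip X (P (f k)) (P (f k)) <=
    INR Q * fsum Q (fun m => if D m then hinner_sqr X (f k) (g m) else 0).
Proof.
  intros HP Hker Hran Hc.
  assert (Hfg : forall x m, D m = true -> hinner_sqr X (P x) (g m) = hinner_sqr X x (g m)).
  { intros x m Hm; destruct (Hker x m Hm) as [A1 A2]; rewrite !rip_hsub in *.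
    unfold hinner_sqr; f_equal; f_equal; lra. }
  apply NNPP; intros Hno.
  (* [Q] is both the constant and the number of tests, so failure for every [Q] makes the normalised
     test against each fixed selected [g m] tend to zero. *)
  assert (Hk : forall Q, exists k,
    INR Q * fsum Q (fun m => if D m then hinner_sqr X (f k) (g m) else 0)
      < rip X (P (f k)) (P (f k))).
  { intros Q; apply NNPP; intros H; apply Hno; exists Q; intros k.
    apply Rnot_lt_le; intros H'; apply H; now exists k. }
  apply choice in Hk; destruct Hk as [s Hs].
  assert (Hpos : forall Q, 0 < rip X (P (f (s Q))) (P (f (s Q)))).
  { intros Q; refine (Rle_lt_trans _ _ _ _ (Hs Q)).
    apply Rmult_le_pos; [apply pos_INR|apply fsum_nonneg; intros m].
    destruct (D m); [apply hinner_sqr_nonneg|lra]. }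
  destruct (Hc s) as [phi [l [Hphi Hl]]].
  { intros Q E; specialize (Hpos Q); rewrite E, rip_hzero in Hpos; lra. }
  assert (Hphi' : forall j, (j <= phi j)%nat).
  { induction j as [|j IH]; [lia|specialize (Hphi j); lia]. }
  set (v := fun j => hscal X (RtoC (/ hnorm X (P (f (s (phi j)))))) (P (f (s (phi j))))).
  change (hconv X v l) in Hl.
  assert (Hinv : forall j, / hnorm X (P (f (s (phi j)))) * / hnorm X (P (f (s (phi j)))) *
     rip X (P (f (s (phi j)))) (P (f (s (phi j)))) = 1).
  { intros j; rewrite <- hnorm_sqr; field.
    intros E; specialize (Hpos (phi j)); rewrite <- hnorm_sqr, E in Hpos; lra. }
  assert (Hv1 : forall j, rip X (v j) (v j) = 1).
  { intros j; rewrite <- (Hinv j); unfold v.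
    change (hscal X (RtoC (/ hnorm X (P (f (s (phi j)))))))
      with (@sscal (hreal X) (/ hnorm X (P (f (s (phi j)))))).
    rewrite sip_scall, sip_scalr; ring. }
  assert (Hann : annih X g D l).
  { intros m Hm.
    assert (Hlim : is_lim_seq (fun j => hinner_sqr X (v j) (g m)) 0).
    { apply is_lim_seq_le_le_loc with (fun _ => 0) (fun j => / INR j).
      (* As [phi j >= j > m], the sum used to pick [s (phi j)] contains the index [m] and carries a
         factor at least [j]; the normalised test is thus at most [1 / j]. *)
      - exists (S m); intros j Hj; split; [apply hinner_sqr_nonneg|].
        specialize (Hphi' j); unfold v; rewrite hinner_sqr_real_scal, Hfg by auto.
        set (w := P (f (s (phi j)))) in *.
        assert (Hj0 : 0 < INR j) by (apply lt_0_INR; lia).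
        assert (Hw : INR j * hinner_sqr X (f (s (phi j))) (g m) <= rip X w w).
        { apply Rle_trans with (2 := Rlt_le _ _ (Hs (phi j))).
          apply Rmult_le_compat; [lra|apply hinner_sqr_nonneg|now apply le_INR|].
          refine (Rle_trans _ _ _ _ (fsum_ge_term (phi j) _ m _ _)); [| |lia].
          - rewrite Hm; apply Rle_refl.
          - intros q; simpl; destruct (D q); [apply hinner_sqr_nonneg|lra]. }
        apply Rmult_le_reg_l with (INR j); auto; rewrite Rinv_r by lra.
        rewrite <- (Hinv j); fold w.
        replace (INR j * (/ hnorm X w * / hnorm X w * hinner_sqr X (f (s (phi j))) (g m)))
          with (/ hnorm X w * / hnorm X w * (INR j * hinner_sqr X (f (s (phi j))) (g m))) by ring.
        apply Rmult_le_compat_l; auto; apply Rle_0_sqr.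
      - apply is_lim_seq_const.
      - replace (Finite 0) with (Rbar_inv p_infty) by reflexivity.
        apply is_lim_seq_inv; [apply is_lim_seq_INR|discriminate]. }
    pose proof (hconv_rip_lim X v l (g m) Hl) as L1.
    pose proof (hconv_rip_lim X v l (itimes (g m)) Hl) as L2.
    pose proof (is_lim_seq_plus' _ _ _ _ (is_lim_seq_mult' _ _ _ _ L1 L1)
                  (is_lim_seq_mult' _ _ _ _ L2 L2)) as L.
    apply is_lim_seq_unique in L; apply is_lim_seq_unique in Hlim.
    unfold hinner_sqr in Hlim; rewrite L in Hlim; injection Hlim; intros E.
    now apply Rplus_sqr_eq_0. }
  apply hconv_rip, is_lim_seq_spec in Hl.
  destruct (Hl (mkposreal 1 Rlt_0_1)) as [n0 Hn0]; specialize (Hn0 n0 (le_n _)).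
  simpl pos in Hn0; rewrite Rminus_0_r in Hn0; apply Rabs_def2 in Hn0; destruct Hn0 as [Hn0 _].
  (* [v n0] is in the range of [P] and [l] in the annihilator, so [|v n0 - l|^2 = 1 + |l|^2],
     contradicting the bound by 1. *)
  assert (Hvl : rip X (v n0) l = 0).
  { unfold v; rewrite rip_hscal, Hran by auto; simpl; lra. }
  rewrite rip_hsub, !rip_hsub_r, (sip_sym (hreal X) l), Hvl, Hv1 in Hn0.
  pose proof (sip_pos (hreal X) l); lra.
Qed.

(** * Lacunary sequences *)

Lemma strictly_increasing_lt (n : nat -> nat) : (forall k, (n k < n (S k))%nat) ->
  forall i j, (i < j)%nat -> (n i < n j)%nat.
Proof. intros H i j Hij; induction Hij; [apply H|]; specialize (H m); lia. Qed.

Lemma strictly_increasing_ge (n : nat -> nat) : (forall k, (n k < n (S k))%nat) ->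
  forall i, (i <= n i)%nat.
Proof. intros H i; induction i; [lia|]; specialize (H i); lia. Qed.

(** The last gap is at least [(d - 1) n (i + p)], hence at least [(d - 1) d^p n i], and [p] is taken
    with [(d - 1) d^p > 1]. Requiring [1 <= i] makes [n i] positive, since [n 0] may be zero. *)
Lemma lacunary_gap (n : nat -> nat) (d : R) : d > 1 -> (forall k, (n k < n (S k))%nat) ->
  (forall k, INR (n (S k)) >= d * INR (n k)) ->
  exists p, forall i, (1 <= i)%nat -> (n i + n (i + p) < n (S (i + p)))%nat.
Proof.
  intros Hd Hn Hr.
  destruct (Pow_x_infinity d ltac:(rewrite Rabs_pos_eq; lra) (/ (d - 1) + 1)) as [p Hp].
  specialize (Hp p (le_n _)); rewrite Rabs_pos_eq in Hp by (apply pow_le; lra).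
  exists p; intros i Hi.
  assert (Hdp : 1 < (d - 1) * d ^ p).
  { assert ((d - 1) * (/ (d - 1) + 1) <= (d - 1) * d ^ p) by (apply Rmult_le_compat_l; lra).
    assert ((d - 1) * (/ (d - 1) + 1) = 1 + (d - 1)) by (field; lra); lra. }
  assert (Hpow : forall q, INR (n (i + q)%nat) >= d ^ q * INR (n i)).
  { induction q as [|q IH]; [rewrite Nat.add_0_r; simpl; lra|].
    rewrite Nat.add_succ_r; specialize (Hr (i + q)%nat); simpl; nra. }
  assert (H1 : 1 <= INR (n i)).
  { pose proof (strictly_increasing_ge n Hn i) as H; apply (le_INR 1); lia. }
  apply INR_lt; rewrite plus_INR; specialize (Hpow p); specialize (Hr (i + p)%nat); nra.
Qed.

(** The points [u - c j] with [j <= i] are distinct and lie between [u - c i] and [u - c 0]; with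
    the points below [u - c i] they are distinct indices of a single partial sum. *)
Lemma fsum_decreasing_le (G : nat -> R) (c : nat -> nat) (u : nat) :
  (forall k, 0 <= G k) ->
  (forall k, (c k < c (S k))%nat) -> forall i, (c i <= u)%nat ->
  fsum (S i) (fun j => G (u - c j)%nat) + fsum (u - c i) G <= fsum (S (u - c 0%nat)) G.
Proof.
  intros G_nonneg Hc i; induction i as [|i IH]; intros Hi.
  - rewrite !fsum_S; unfold fsum at 1; simpl; lra.
  - specialize (Hc i); rewrite (fsum_S (S i)).
    pose proof (fsum_S (u - c (S i)) G) as E.
    pose proof (fsum_mono (S (u - c (S i))) (u - c i) G G_nonneg ltac:(lia)).
    specialize (IH ltac:(lia)); lra.
Qed.

(* For fixed [i] the differences [n i - n j] are distinct and, by lacunarity,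
   exceed [n (i - S p)]; so the windows they occupy overlap at most [S p] times. *)
Lemma lacunary_double_sum (n : nat -> nat) (p J m : nat) (G : nat -> R) (tau : R) :
  (forall k, (n k < n (S k))%nat) -> (1 <= J)%nat ->
  (forall i, (J <= i)%nat -> (n i + n (i + p) < n (S (i + p)))%nat) ->
  (forall k, 0 <= G k) -> (forall M, fsum M (fun k => G (J + k)%nat) <= tau) ->
  forall K, fsum K (fun j => fsum K (fun i => if (j <? i)%nat
     then G (m + (n (J + S p + i) - n (J + S p + j)))%nat else 0)) <= INR (S p) * tau.
Proof.
  intros Hn HJ Hgap HG Htau K.
  pose (G' := fun t => G (m + t)%nat).
  pose (sg := fun i => fsum (n (J + i)%nat) G').
  assert (HG' : forall k, 0 <= G' k) by (intros; apply HG).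
  (* As [n i >= i], every index of [G] occurring in this difference is at least [J], so the tail
     bound applies. *)
  assert (Hsg : forall q, sg (K + q)%nat - sg q <= tau).
  { intros q; unfold sg.
    pose proof (strictly_increasing_ge n Hn (J + q)) as H0.
    assert (H1 : (n (J + q) <= n (J + (K + q)))%nat).
    { destruct K; [apply le_n|apply Nat.lt_le_incl, strictly_increasing_lt; auto; lia]. }
    set (a := n (J + q)%nat) in *; set (b := n (J + (K + q))%nat) in *.
    replace b with (a + (b - a))%nat at 1 by lia; rewrite fsum_add.
    pose proof (Htau ((m + a - J) + (b - a))%nat) as H2; rewrite fsum_add in H2.
    pose proof (fsum_nonneg (m + a - J) (fun k => G (J + k)%nat) (fun k => HG _)).
    rewrite (fsum_ext (b - a) (fun k => G' (a + k)%nat) (fun k => G (J + (m + a - J + k))%nat)).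
    - lra.
    - intros k _; unfold G'; f_equal; lia. }
  rewrite fsum_swap.
  (* Row 0 is empty. In a later row [i] all differences are below [n (J + S p + i)], and the
     smallest exceeds [n (J + i)] by the gap condition. *)
  apply Rle_trans with (fsum K (fun i => sg (S p + i)%nat + (-1) * sg i)).
  { apply fsum_le; intros i Hi.
    rewrite fsum_if by lia.
    destruct i as [|i].
    - assert (sg 0%nat <= sg (S p + 0)%nat).
      { apply fsum_mono; auto; apply Nat.lt_le_incl, strictly_increasing_lt; auto; lia. }
      unfold fsum at 1; simpl; simpl in H; lra.
    - pose proof (fsum_decreasing_le G' (fun j => n (J + S p + j)%nat)
                    (n (J + S p + S i)%nat) HG') as H.
      specialize (H ltac:(intros k; cbv beta; apply strictly_increasing_lt; auto; lia) i
                    ltac:(cbv beta; apply Nat.lt_le_incl, strictly_increasing_lt; auto; lia)).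
      cbv beta in H.
      pose proof (strictly_increasing_ge n Hn (J + S p + 0)) as H0.
      assert (H1 : (n (J + S p + 0) < n (J + S p + S i))%nat)
        by (apply strictly_increasing_lt; auto; lia).
      pose proof (fsum_mono (S (n (J + S p + S i) - n (J + S p + 0)))%nat
                    (n (J + (S p + S i)))%nat G' HG') as H2.
      replace (J + (S p + S i))%nat with (J + S p + S i)%nat in H2 by lia.
      specialize (H2 ltac:(lia)).
      pose proof (Hgap (J + S i)%nat ltac:(lia)) as H3.
      replace (S (J + S i + p)) with (J + S p + S i)%nat in H3 by lia.
      replace (J + S i + p)%nat with (J + S p + i)%nat in H3 by lia.
      pose proof (fsum_mono (n (J + S i)%nat) (n (J + S p + S i) - n (J + S p + i))%nat G' HG'
                    ltac:(lia)) as H4.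
      unfold sg; replace (J + (S p + S i))%nat with (J + S p + S i)%nat by lia.
      unfold G' in *; lra. }
  (* The sum telescopes with stride [S p], leaving the [S p] differences [sg (K + q) - sg q]. *)
  rewrite fsum_plus, fsum_scal.
  pose proof (fsum_add (S p) K sg) as E1; rewrite Nat.add_comm, fsum_add in E1.
  assert (E2 : fsum (S p) (fun q => sg (K + q)%nat + (-1) * sg q) <= fsum (S p) (fun _ => tau)).
  { apply fsum_le; intros q _; specialize (Hsg q); lra. }
  rewrite fsum_plus, fsum_scal in E2.
  rewrite fsum_const in E2; lra.
Qed.

(** * Sequences orthogonal to the orbit of a lacunary series *)

Section Orbit.
Variables (X : CHilbert) (N : nat) (f : nat -> X) (n : nat -> nat) (p J : nat).
Hypothesis N_pos : (1 <= N)%nat.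
Hypothesis n_incr : forall k, (n k < n (S k))%nat.
Hypothesis f_supp : forall k, f k <> hzero X -> exists i, n i = k.
Hypothesis J_pos : (1 <= J)%nat.
Hypothesis n_gap : forall i, (J <= i)%nat -> (n i + n (i + p) < n (S (i + p)))%nat.

(** Orthogonality is used at the shift by [n (J + S p + j) - m]. The gap puts all earlier spectral
    points below this shift, so the term at [m] comes first and balances the later ones. *)
Lemma orbit_orthogonal_lim (h : nat -> X) (m j : nat) : (m <= J)%nat ->
  (forall k, is_series (fun t => rip X (f (t + N * k)%nat) (h t)) 0) ->
  (m mod N = n (J + S p + j) mod N)%nat ->
  is_lim_seq (fun K => fsum K (fun i => if (j <? i)%nat
     then rip X (f (n (J + S p + i)%nat)) (h (m + (n (J + S p + i) - n (J + S p + j)))%nat)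
     else 0))
    (- rip X (f (n (J + S p + j)%nat)) (h m)).
Proof.
  intros Hm Horth Hmod.
  set (j0 := (J + S p + j)%nat) in *.
  pose proof (n_gap (J + j)%nat ltac:(lia)) as Hg.
  replace (S (J + j + p)) with j0 in Hg by (unfold j0; lia).
  pose proof (strictly_increasing_ge n n_incr (J + j)) as Hge.
  pose (k := ((n j0 - m) / N)%nat).
  assert (Hk : (N * k + m = n j0)%nat).
  { unfold k.
    pose proof (Nat.div_mod (n j0) N ltac:(lia)) as D1.
    pose proof (Nat.div_mod m N ltac:(lia)) as D2.
    assert (m / N <= n j0 / N)%nat by (apply Nat.Div0.div_le_mono; lia).
    replace (n j0 - m)%nat with ((n j0 / N - m / N) * N)%nat by nia.
    rewrite Nat.div_mul by lia; nia. }
  (* [t] lists the positions where the shifted series can be nonzero, starting with [t 0 = m]. *)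
  pose (t := fun i => (m + (n (j0 + i) - n j0))%nat).
  pose (u := fun x => rip X (f (x + N * k)%nat) (h x)).
  assert (Hmono : forall i, (n j0 <= n (j0 + i))%nat).
  { intros i; destruct i; [rewrite Nat.add_0_r; apply le_n|].
    apply Nat.lt_le_incl, strictly_increasing_lt; auto; lia. }
  assert (Ht : forall i, (t i < t (S i))%nat).
  { intros i; unfold t; rewrite Nat.add_succ_r; specialize (n_incr (j0 + i)%nat).
    specialize (Hmono i); lia. }
  assert (Htf : forall i, u (t i) = rip X (f (n (j0 + i)%nat)) (h (t i))).
  { intros i; unfold u; do 2 f_equal; unfold t; specialize (Hmono i); lia. }
  assert (Hu : forall x, u x <> 0 -> exists i, t i = x).
  { intros x Hx; destruct (f_supp (x + N * k)%nat) as [q Hq].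
    { intros E; apply Hx; unfold u; rewrite E; apply rip_hzero. }
    destruct (Nat.le_gt_cases j0 q) as [Hjq|Hjq].
    - exists (q - j0)%nat; unfold t; specialize (Hmono (q - j0)%nat).
      replace (j0 + (q - j0))%nat with q in * by lia; lia.
    (* A spectral point of index [q < j0] is at most [n (j0 - 1)], which is less than
       [n j0 - m = N * k]. *)
    - exfalso.
      assert (n q <= n (J + j + p))%nat; [|lia].
      destruct (Nat.eq_dec q (J + j + p)) as [->|]; [apply le_n|].
      apply Nat.lt_le_incl, strictly_increasing_lt; auto; unfold j0 in Hjq; lia. }
  specialize (Horth k); apply is_series_fsum in Horth; fold u in Horth.
  assert (L1 : is_lim_seq (fun L => fsum (S L) (fun i => u (t i))) 0).
  { apply (is_lim_seq_ext (fun L => fsum (S (t L)) u)); [apply fsum_subseq; auto|].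
    apply (is_lim_seq_subseq (fun L => fsum L u) 0 (fun L => S (t L))); auto.
    apply eventually_subseq; intros i; specialize (Ht i); lia. }
  (* The summands with [i <= j] are zero, so the sums may start at [S j]; they are the sums along
     [t] without the term at [t 0]. *)
  apply (is_lim_seq_incr_n _ (S j)).
  apply (is_lim_seq_ext (fun L => fsum (S L) (fun i => u (t i)) - rip X (f (n j0)) (h m))).
  - intros L; rewrite Nat.add_comm, (fsum_add (S j) L), (fsum_0 (S j)).
    + rewrite (fsum_add 1 L), fsum_S, Htf; unfold fsum at 1; simpl fold_right.
      replace (t 0%nat) with m by (unfold t; rewrite Nat.add_0_r; lia).
      rewrite Nat.add_0_r.
      rewrite (fsum_ext L (fun i => u (t (1 + i)%nat)) (fun i => if (j <? S j + i)%nat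
        then rip X (f (n (J + S p + (S j + i))%nat)) (h (m + (n (J + S p + (S j + i)) - n j0))%nat)
        else 0)); [lra|].
      intros i _; rewrite (proj2 (Nat.ltb_lt j (S j + i))) by lia.
      rewrite Htf; unfold t.
      replace (J + S p + (S j + i))%nat with (j0 + (1 + i))%nat by (unfold j0; lia); reflexivity.
    + intros i Hi; now rewrite (proj2 (Nat.ltb_ge j i)) by lia.
  - replace (Finite (- rip X (f (n j0)) (h m))) with (Finite (0 - rip X (f (n j0)) (h m)))
      by (f_equal; ring).
    apply is_lim_seq_minus'; [exact L1|apply is_lim_seq_const].
Qed.

(** Cauchy-Schwarz bounds the square of each truncated sum by [rho] times a row of the double sum in
    [lacunary_double_sum]. Taking [h] to be [g] and then [i g] gives the real and imaginary
    parts. *)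
Lemma orbit_orthogonal_energy (h b : nat -> X) (m : nat) (rho tau : R) : (m <= J)%nat ->
  (forall k, is_series (fun t => rip X (f (t + N * k)%nat) (h t)) 0) ->
  (forall i x, (x mod N = n i mod N)%nat -> rip X (f (n i)) (h x) = rip X (b i) (h x)) ->
  (forall M, fsum M (fun i => rip X (b (J + S p + i)%nat) (b (J + S p + i)%nat)) <= rho) ->
  (forall M, fsum M (fun k => rip X (h (J + k)%nat) (h (J + k)%nat)) <= tau) ->
  forall L, fsum L (fun j => if (m mod N =? n (J + S p + j) mod N)%nat
    then rip X (f (n (J + S p + j)%nat)) (h m) * rip X (f (n (J + S p + j)%nat)) (h m) else 0)
    <= rho * (INR (S p) * tau).
Proof.
  intros Hm Horth Hb Hrho Htau L.
  pose (c := fun j i => (m + (n (J + S p + i) - n (J + S p + j)))%nat).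
  pose (w := fun K j => if (m mod N =? n (J + S p + j) mod N)%nat
    then fsum K (fun i => if (j <? i)%nat then rip X (f (n (J + S p + i)%nat)) (h (c j i)) else 0)
    else 0).
  assert (Hrho0 : 0 <= rho).
  { refine (Rle_trans _ _ _ _ (Hrho 0%nat)); apply Rle_refl. }
  (* Both ranges are cut at the same [K], as in [lacunary_double_sum]; afterwards [K] tends to
     infinity with [L] fixed. *)
  assert (HK : forall K, (L <= K)%nat -> fsum L (fun j => w K j * w K j) <= rho * (INR (S p) * tau)).
  { intros K HLK.
    apply Rle_trans with (fsum K (fun j => w K j * w K j)).
    { apply fsum_mono; auto; intros; apply Rle_0_sqr. }
    apply Rle_trans with (rho * fsum K (fun j => fsum K (fun i => if (j <? i)%nat
      then rip X (h (c j i)) (h (c j i)) else 0))).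
    2: { apply Rmult_le_compat_l; auto.
         apply (lacunary_double_sum n p J m (fun x => rip X (h x) (h x))); auto.
         intros; apply sip_pos. }
    rewrite <- fsum_scal; apply fsum_le; intros j Hj; unfold w.
    assert (Hs0 : 0 <= fsum K (fun i => if (j <? i)%nat then rip X (h (c j i)) (h (c j i)) else 0)).
    { apply fsum_nonneg; intros i; destruct (j <? i)%nat; [apply (sip_pos (hreal X))|lra]. }
    destruct (m mod N =? n (J + S p + j) mod N)%nat eqn:Emod;
      [|rewrite Rmult_0_l; now apply Rmult_le_pos].
    apply Nat.eqb_eq in Emod.
    pose (x := fun i => if (j <? i)%nat then b (J + S p + i)%nat else hzero X).
    pose (y := fun i => if (j <? i)%nat then h (c j i) else hzero X).
    rewrite (fsum_ext K _ (fun i => rip X (x i) (y i))).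
    (* Since [m] and [n (J + S p + j)] agree modulo [N], the index [c j i] is congruent to
       [n (J + S p + i)], which permits replacing [f] by [b]. *)
    2: { intros i _; unfold x, y; destruct (Nat.ltb_spec j i) as [Hji|]; [|now rewrite rip_hzero].
         apply Hb; unfold c.
         assert (n (J + S p + j) < n (J + S p + i))%nat
           by (apply strictly_increasing_lt; auto; lia).
         rewrite Nat.Div0.add_mod, Emod, <- Nat.Div0.add_mod; f_equal; lia. }
    rewrite (fsum_ext K (fun i => if (j <? i)%nat then rip X (h (c j i)) (h (c j i)) else 0)
               (fun i => rip X (y i) (y i))).
    2: { intros i _; unfold y; destruct (j <? i)%nat; auto; now rewrite rip_hzero. }
    refine (Rle_trans _ _ _ (fsum_CauchySchwarz (hreal X) K x y) _).
    apply Rmult_le_compat_r; [apply fsum_nonneg; intros; apply sip_pos|].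
    refine (Rle_trans _ _ _ _ (Hrho K)); apply fsum_le; intros i _; unfold x.
    destruct (j <? i)%nat; [apply Rle_refl|rewrite rip_hzero; apply (sip_pos (hreal X))]. }
  refine (is_lim_seq_le_loc (fun K => fsum L (fun j => w K j * w K j)) (fun _ => _)
            (Finite _) (Finite _) _ _ (is_lim_seq_const _)).
  { exists L; exact HK. }
  apply is_lim_seq_fsum; intros j _; unfold w.
  destruct (m mod N =? n (J + S p + j) mod N)%nat eqn:Emod.
  - apply Nat.eqb_eq in Emod.
    pose proof (orbit_orthogonal_lim h m j Hm Horth Emod) as Hl.
    rewrite <- Rmult_opp_opp; apply is_lim_seq_mult'; exact Hl.
  - replace (Finite 0) with (Finite (0 * 0)) by (f_equal; ring).
    apply is_lim_seq_mult'; apply is_lim_seq_const.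
Qed.

End Orbit.

Lemma uniform_bound_lt (B : nat -> nat -> Prop) :
  (forall r Q Q', (Q <= Q')%nat -> B r Q -> B r Q') -> (forall r, exists Q, B r Q) ->
  forall N, exists Q, forall r, (r < N)%nat -> B r Q.
Proof.
  intros Hmono HB N; induction N as [|N [Q HQ]]; [exists 0%nat; lia|].
  destruct (HB N) as [Q' HQ']; exists (Q + Q')%nat; intros r Hr.
  destruct (Nat.eq_dec r N) as [->|Hne].
  - apply (Hmono N Q'); auto; lia.
  - apply (Hmono r Q); [lia|apply HQ; lia].
Qed.

(* The energy [rho] of the tail of the projected coefficients satisfies [rho <= rho / 2]. *)
Lemma orbit_orthogonal_tail (X : CHilbert) (N : nat) (Lam : nat -> Prop) (f g : nat -> X) :
  (1 <= N)%nat -> lacunary Lam -> (forall k, f k <> hzero X -> Lam k) ->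
  sqsum (hreal X) f -> sqsum (hreal X) g -> completely_rel_compact X f ->
  (forall k, is_series (fun t => rip X (f (t + N * k)%nat) (g t)) 0) ->
  (forall k, is_series (fun t => rip X (f (t + N * k)%nat) (itimes (g t))) 0) ->
  exists M, forall k m, (M <= k)%nat -> (m mod N = k mod N)%nat ->
    rip X (f k) (g m) = 0 /\ rip X (f k) (itimes (g m)) = 0.
Proof.
  intros HN [n [d [Hd [Hn [Hr HLam]]]]] Hsupp Hf Hg Hcrc Ho1 Ho2.
  assert (Hfn : forall k, f k <> hzero X -> exists i, n i = k) by (intros k Hk; now apply HLam, Hsupp).
  destruct (lacunary_gap n d Hd Hn Hr) as [p Hgap].
  pose (D := fun r m : nat => (m mod N =? r)%nat).
  assert (HP : forall r, exists P, orth_proj X P /\ (forall x, annih X g (D r) (hsub X x (P x))) /\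
     (forall x z, annih X g (D r) z -> rip X (P x) z = 0))
    by (intros r; apply annihilator_projection).
  apply choice in HP; destruct HP as [P HP].
  assert (HQ : exists Q, forall r, (r < N)%nat -> forall k, rip X (P r (f k)) (P r (f k)) <=
     INR Q * fsum Q (fun m => if D r m then hinner_sqr X (f k) (g m) else 0)).
  { apply uniform_bound_lt.
    - intros r Q Q' HQ H k; refine (Rle_trans _ _ _ (H k) _).
      assert (Hpos : forall m, 0 <= if D r m then hinner_sqr X (f k) (g m) else 0).
      { intros m; destruct (D r m); [apply hinner_sqr_nonneg|lra]. }
      apply Rmult_le_compat; [apply pos_INR|now apply fsum_nonneg|now apply le_INR|].
      now apply fsum_mono.
    - intros r; destruct (HP r) as [H1 [H2 H3]].
      apply compact_coefficient_bound; auto. }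
  destruct HQ as [Q HQ].
  (* One factor [Q] comes from the compactness bound, one from summing over [m < Q], and a factor 2
     from real and imaginary parts; [a] brings the total down to [rho / 2]. *)
  set (a := 4 * (INR Q + 1) * (INR Q + 1) * INR (S p)).
  assert (Hp1 : 1 <= INR (S p)) by (rewrite S_INR; pose proof (pos_INR p); lra).
  pose proof (pos_INR Q) as HQ0.
  assert (Ha : 0 < a) by (unfold a; repeat apply Rmult_lt_0_compat; lra).
  destruct (fsum_tail_small (fun k => rip X (g k) (g k)) (fun k => sip_pos (hreal X) (g k)) Hg (/ a))
    as [n0 Htail]; [now apply Rinv_0_lt_compat|].
  (* The summand [S Q] ensures [1 <= J], and [m <= J] for every [m < Q]. *)
  set (J := (n0 + S Q)%nat).
  assert (HJ : forall M, fsum M (fun k => rip X (g (J + k)%nat) (g (J + k)%nat)) <= / a).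
  { intros M; specialize (Htail (S Q + M)%nat); rewrite fsum_add in Htail.
    pose proof (fsum_nonneg (S Q) (fun k => rip X (g (n0 + k)%nat) (g (n0 + k)%nat))
                  (fun k => sip_pos (hreal X) _)).
    rewrite (fsum_ext M _ (fun k => rip X (g (n0 + (S Q + k))%nat) (g (n0 + (S Q + k))%nat))).
    - lra.
    - intros k _; unfold J; now rewrite Nat.add_assoc. }
  pose (b := fun i => P (n i mod N)%nat (f (n i))).
  assert (Hb : forall i x, (x mod N = n i mod N)%nat ->
     rip X (f (n i)) (g x) = rip X (b i) (g x) /\
     rip X (f (n i)) (itimes (g x)) = rip X (b i) (itimes (g x))).
  { intros i x Hx; destruct (proj1 (proj2 (HP (n i mod N)%nat)) (f (n i)) x) as [A1 A2].
    - now apply Nat.eqb_eq.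
    - rewrite !rip_hsub in *; unfold b; split; lra. }
  assert (Hbf : forall i, rip X (b i) (b i) <= rip X (f (n i)) (f (n i))).
  { intros i; destruct (HP (n i mod N)%nat) as [_ [H1 H2]].
    specialize (H2 (f (n i)) _ (H1 (f (n i)))); fold (b i) in H2.
    pose proof (sip_pos (hreal X) (hsub X (f (n i)) (b i))) as H3.
    rewrite rip_hsub, !rip_hsub_r in H3; rewrite rip_hsub_r in H2.
    pose proof (sip_sym (hreal X) (f (n i)) (b i)); lra. }
  set (beta := fun i => rip X (b (J + S p + i)%nat) (b (J + S p + i)%nat)).
  assert (Hbeta0 : forall i, 0 <= beta i) by (intros; apply (sip_pos (hreal X))).
  set (F := fun k => rip X (f k) (f k)).
  assert (HF0 : forall k, 0 <= F k) by (intros; apply (sip_pos (hreal X))).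
  (* Convergence makes [Series beta] the true energy; it is dominated by the energy of [f] along its
     spectrum. *)
  assert (Hbeta : ex_series beta).
  { apply (Series_bounded beta (Series F)); auto; intros M.
    apply Rle_trans with (fsum (J + S p + M) (fun i => F (n i))).
    - rewrite fsum_add.
      pose proof (fsum_nonneg (J + S p) (fun i => F (n i)) (fun i => HF0 _)).
      pose proof (fsum_le M beta (fun i => F (n (J + S p + i)%nat)) (fun i _ => Hbf _)); lra.
    - replace (J + S p + M)%nat with (S (J + p + M)) by lia.
      rewrite <- fsum_subseq; auto; [now apply fsum_le_Series|].
      intros x Hx; apply Hfn; intros E; apply Hx; unfold F; rewrite E; apply rip_hzero. }
  pose proof (fsum_le_Series beta Hbeta0 Hbeta) as Hrho.
  set (rho := Series beta) in *.
  assert (Hrho0 : 0 <= rho) by (refine (Rle_trans _ _ _ _ (Hrho 0%nat)); apply Rle_refl).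
  set (e := rho * (INR (S p) * / a)).
  assert (Hen : forall m, (m < Q)%nat -> forall L, fsum L (fun j => if D (n (J + S p + j) mod N)%nat m
     then hinner_sqr X (f (n (J + S p + j)%nat)) (g m) else 0) <= e + e).
  { intros m Hm L.
    assert (HJ1 : (1 <= J)%nat) by (unfold J; lia).
    assert (HmJ : (m <= J)%nat) by (unfold J; lia).
    assert (HgJ : forall i, (J <= i)%nat -> (n i + n (i + p) < n (S (i + p)))%nat)
      by (intros; apply Hgap; lia).
    pose proof (orbit_orthogonal_energy X N f n p J HN Hn Hfn HJ1 HgJ g b m rho (/ a) HmJ Ho1
      (fun i x Hx => proj1 (Hb i x Hx)) Hrho HJ L) as E1.
    pose proof (orbit_orthogonal_energy X N f n p J HN Hn Hfn HJ1 HgJ (fun k => itimes (g k)) b m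
      rho (/ a) HmJ Ho2 (fun i x Hx => proj2 (Hb i x Hx)) Hrho) as E2.
    assert (HJ2 : forall M, fsum M (fun k => rip X (itimes (g (J + k)%nat)) (itimes (g (J + k)%nat)))
                            <= / a).
    { intros M; refine (Rle_trans _ _ _ (Req_le _ _ _) (HJ M)).
      apply fsum_ext; intros; apply rip_itimes2. }
    specialize (E2 HJ2 L).
    refine (Rle_trans _ _ _ _ (Rplus_le_compat _ _ _ _ E1 E2)).
    rewrite <- fsum_plus; apply fsum_le; intros j _; unfold D, hinner_sqr.
    destruct (m mod N =? n (J + S p + j) mod N)%nat; lra. }
  assert (Hhalf : rho <= rho / 2).
  { apply (Series_bounded beta); auto; intros L.
    apply Rle_trans with (fsum L (fun j => INR Q * fsum Q (fun m =>
       if D (n (J + S p + j) mod N)%nat m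
       then hinner_sqr X (f (n (J + S p + j)%nat)) (g m) else 0))).
    { apply fsum_le; intros j _; apply HQ, Nat.mod_upper_bound; lia. }
    rewrite fsum_scal, fsum_swap.
    apply Rle_trans with (INR Q * fsum Q (fun _ => e + e)).
    { apply Rmult_le_compat_l; auto; apply fsum_le; intros m Hm; now apply Hen. }
    rewrite fsum_const.
    assert (Hea : e * (2 * (INR Q + 1) * (INR Q + 1)) = rho / 2) by (unfold e, a; field; lra).
    assert (He0 : 0 <= e).
    { unfold e; repeat apply Rmult_le_pos; auto; [lra|]; apply Rlt_le, Rinv_0_lt_compat, Ha. }
    assert (INR Q * INR Q * e <= (INR Q + 1) * (INR Q + 1) * e)
      by (apply Rmult_le_compat_r; nra).
    lra. }
  (* [rho] is nonnegative and at most its half, hence zero, and it dominates every [beta j]. *)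
  assert (Hb0 : forall j, b (J + S p + j)%nat = hzero X).
  { intros j; apply rip_eq0; apply Rle_antisym; [|apply (sip_pos (hreal X))].
    pose proof (fsum_ge_term (S j) beta j Hbeta0 ltac:(lia)).
    specialize (Hrho (S j)); unfold beta at 1 in H; lra. }
  exists (n (J + S p)%nat); intros k m Hk Hm.
  destruct (classic (f k = hzero X)) as [->|Hfk]; [now rewrite !rip_hzero|].
  destruct (Hfn k Hfk) as [i <-].
  assert (Hi : (J + S p <= i)%nat).
  { apply Nat.nlt_ge; intros Hlt; pose proof (strictly_increasing_lt n Hn _ _ Hlt); lia. }
  destruct (Hb i m Hm) as [-> ->].
  replace i with (J + S p + (i - (J + S p)))%nat by lia.
  rewrite Hb0; now rewrite !rip_hzero.
Qed.

(** * Cyclic vectors *)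

Section Cyclic.
Variable X : CHilbert.
Implicit Types (f g h : nat -> X) (l : list (Cx * nat)).

Lemma in_H2_sqsum f : in_H2 X f <-> sqsum (hreal X) f.
Proof.
  split; intros [s Hs]; exists s.
  - apply is_series_Reals in Hs; apply (is_series_ext _ _ _ (fun k => hnorm_sqr X (f k)) Hs).
  - apply is_series_Reals; apply (is_series_ext _ _ _ (fun k => eq_sym (hnorm_sqr X (f k))) Hs).
Qed.

Lemma lincomb_app l l' (v : nat -> X) :
  lincomb X (l ++ l') v = hadd X (lincomb X l v) (lincomb X l' v).
Proof.
  induction l as [|q l IH]; simpl.
  - now rewrite hadd_comm, hadd_zero.
  - now rewrite IH, hadd_assoc.
Qed.

Lemma hscal_hzero c : hscal X c (hzero X) = hzero X.
Proof. apply rip_eq0; rewrite !rip_hscal, !rip_hzero; lra. Qed.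

Lemma lincomb_scal c l (v : nat -> X) :
  lincomb X (map (fun q => (Cmul c (fst q), snd q)) l) v = hscal X c (lincomb X l v).
Proof.
  induction l as [|q l IH]; simpl.
  - now rewrite hscal_hzero.
  - now rewrite IH, hscal_mul, hscal_addv.
Qed.

Lemma lincomb_reindex (s : nat -> nat) l (v : nat -> X) :
  lincomb X (map (fun q => (fst q, s (snd q))) l) v = lincomb X l (fun k => v (s k)).
Proof. induction l as [|q l IH]; simpl; [|rewrite IH]; reflexivity. Qed.

Lemma lincomb_ext l (v w : nat -> X) : (forall k, v k = w k) -> lincomb X l v = lincomb X l w.
Proof. intros H; induction l as [|q l IH]; simpl; [|rewrite IH, H]; reflexivity. Qed.

Lemma lincomb_orthogonal l (v : nat -> X) (y : X) (m : nat) :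
  (forall k, (m <= k)%nat -> rip X (v k) y = 0 /\ rip X (v k) (itimes y) = 0) ->
  Forall (fun q => (m <= snd q)%nat) l -> rip X (lincomb X l v) y = 0.
Proof.
  intros Hv Hl; induction Hl as [|q l Hq Hl IH]; simpl lincomb; [apply rip_hzero|].
  destruct (Hv _ Hq) as [A1 A2]; rewrite rip_hadd, rip_hscal, IH, A1, A2; lra.
Qed.

(** Place [y] in block [m] and zero elsewhere. On that block the [k]-th shift of [f] shows block
    [m + k] of [f], so any orbit approximant restricts to a combination of blocks of index at least
    [m]. *)
Lemma blocks_span_dense_of_cyclic N m f : cyclic_bshiftN X N f -> blocks_span_dense X N m f.
Proof.
  intros Hc y eps He.
  pose (g := fun k => if ((N * m <=? k) && (k <? N * m + N))%nat%bool
                      then y (k - N * m)%nat else hzero X).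
  destruct (Hc g) with (eps := eps) as [l [s [Hs Hlt]]]; auto.
  { apply in_H2_sqsum, (ex_series_incr_n _ (N * m + N)).
    exists 0; apply is_series_fsum, is_lim_seq_ext with (fun _ => 0); [|apply is_lim_seq_const].
    intros q; symmetry; apply fsum_0; intros k _; unfold g.
    rewrite (proj2 (Nat.ltb_ge (N * m + N + k) (N * m + N))) by lia.
    rewrite Bool.andb_false_r; apply rip_hzero. }
  exists (map (fun q => (fst q, (m + snd q)%nat)) l); split.
  { apply Forall_map, Forall_forall; intros q _; simpl; lia. }
  apply Rle_lt_trans with (2 := Hlt).
  apply is_series_Reals in Hs; rewrite <- (is_series_unique _ _ Hs).
  set (u := fun k => _) in Hs |- *.
  assert (Hu0 : forall k, 0 <= u k) by (intros k; apply pow2_ge_0).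
  refine (Rle_trans _ _ _ _ (fsum_le_Series u Hu0 (ex_intro _ s Hs) (N * m + N)%nat)).
  rewrite fsum_add; pose proof (fsum_nonneg (N * m) u Hu0).
  rewrite (fsum_ext N _ (fun i => u (N * m + i)%nat)); [lra|].
  intros i Hi; unfold u, g.
  rewrite (proj2 (Nat.leb_le (N * m) (N * m + i))) by lia.
  rewrite (proj2 (Nat.ltb_lt (N * m + i) (N * m + N))) by lia; simpl andb; cbv iota.
  replace (N * m + i - N * m)%nat with i by lia.
  rewrite (lincomb_reindex (fun k => (m + k)%nat)).
  do 3 f_equal; apply lincomb_ext; intros k; unfold bshift_pow; f_equal; lia.
Qed.

Lemma sqsum_shift f j : sqsum (hreal X) f -> sqsum (hreal X) (fun t => f (t + j)%nat).
Proof.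
  intros Hf; apply (ex_series_incr_n _ j) in Hf.
  apply (ex_series_ext (fun k => rip X (f (j + k)%nat) (f (j + k)%nat))); auto.
  intros k; now rewrite Nat.add_comm.
Qed.

(* The error of projecting [g0] onto the closed span of the orbit. *)
Lemma orbit_projection N f g0 : sqsum (hreal X) f -> sqsum (hreal X) g0 ->
  exists g, sqsum (hreal X) g /\
    (forall k, is_series (fun t => rip X (f (t + N * k)%nat) (g t)) 0) /\
    (forall k, is_series (fun t => rip X (f (t + N * k)%nat) (itimes (g t))) 0) /\
    ((forall t, rip X (g t) (g t) = 0) -> forall eps, 0 < eps ->
      exists l, H2_dist2_lt X g0 (fun t => lincomb X l (fun k => bshift_pow X (N * k) f t)) eps).
Proof.
  intros Hf Hg0.
  set (G0 := exist _ g0 Hg0 : l2 (hreal X)).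
  (* Membership is stated coordinatewise, so no equality between elements of the sigma type is
     required. *)
  pose (V := fun h : l2 (hreal X) => exists l, forall t,
    proj1_sig h t = lincomb X l (fun k => bshift_pow X (N * k) f t)).
  destruct (projection (l2 (hreal X)) V G0) as [p [Hp Hperp]].
  { exists (sscal 0 G0); exists nil; intros t; apply (rip_eq0 X).
    change (rip X (sscal 0 (g0 t)) (sscal 0 (g0 t)) = 0); rewrite sip_scall; lra. }
  { intros u v [l Hl] [l' Hl']; exists (l ++ l'); intros t.
    rewrite lincomb_app, <- Hl, <- Hl'; reflexivity. }
  { intros c v [l Hl]; exists (map (fun q => (Cmul (RtoC c) (fst q), snd q)) l); intros t.
    rewrite lincomb_scal, <- Hl; reflexivity. }
  set (g := proj1_sig (ssub G0 p)).
  assert (Hg : sqsum (hreal X) g) by apply (proj2_sig (ssub G0 p)).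
  assert (Hort : forall h, sqsum (hreal X) h ->
    (exists l, forall t, h t = lincomb X l (fun k => bshift_pow X (N * k) f t)) ->
    is_series (fun t => rip X (h t) (g t)) 0).
  { intros h Hh Hl; pose proof (Hperp (exist _ h Hh) Hl) as E.
    pose proof (Series_correct _ (ex_series_sip (hreal X) g h Hg Hh)) as E'.
    change (Series (fun t => rip X (g t) (h t)) = 0) in E; rewrite E in E'.
    apply (is_series_ext _ _ _ (fun t => sip_sym (hreal X) (g t) (h t)) E'). }
  exists g; split; [exact Hg|split; [|split]].
  - intros k; apply Hort; [now apply sqsum_shift|].
    exists ((Defs.C1, k) :: nil); intros t; simpl; now rewrite hadd_zero, hscal_one.
  - intros k.
    (* The span is complex, hence contains [i] times each shift of [f]; moving [i] to the other
       argument only changes the sign. *)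
    assert (Hi : is_series (fun t => rip X (itimes (f (t + N * k)%nat)) (g t)) 0).
    { apply Hort.
      - apply (ex_series_ext (fun t => rip X (f (t + N * k)%nat) (f (t + N * k)%nat))).
        + intros t; symmetry; apply rip_itimes2.
        + now apply sqsum_shift.
      - exists ((mkCx 0 1, k) :: nil); intros t; simpl; now rewrite hadd_zero. }
    apply is_series_opp in Hi.
    change (is_series (fun t => - rip X (itimes (f (t + N * k)%nat)) (g t)) (- 0)) in Hi.
    rewrite Ropp_0 in Hi.
    apply (is_series_ext _ _ _ (fun t => eq_sym (rip_itimes_r X _ _)) Hi).
  (* If [g] vanishes, [p] agrees with [g0] in every coordinate, so an element of [V] near [p]
     approximates [g0]. *)
  - intros Hz eps He; destruct (Hp eps He) as [v [[l Hl] Hv]]; exists l.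
    exists (sip (ssub p v) (ssub p v)); split; auto.
    pose proof (Series_correct _ (proj2_sig (ssub p v))) as E.
    apply is_series_Reals; refine (is_series_ext _ _ _ _ E); intros t.
    rewrite <- Hl, hnorm_sqr.
    assert (Ht : forall y : X, rip X (g0 t) y = rip X (proj1_sig p t) y).
    { intros y; pose proof (rip_eq0 X _ (Hz t)) as E0.
      pose proof (rip_hzero X y) as E1; rewrite <- E0 in E1.
      change (rip X (ssub (g0 t) (proj1_sig p t)) y = 0) in E1; rewrite sip_subl in E1; lra. }
    set (x := proj1_sig p t) in *; set (y := proj1_sig v t).
    change (rip X (ssub x y) (ssub x y) = rip X (hsub X (g0 t) y) (hsub X (g0 t) y)).
    rewrite sip_subl, !sip_subr, rip_hsub, !rip_hsub_r, !Ht.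
    rewrite (sip_sym (hreal X) x (g0 t)), (sip_sym (hreal X) y (g0 t)), !Ht.
    now rewrite (sip_sym (hreal X) y x).
Qed.

(** The projection error [g] vanishes coordinate by coordinate: late blocks of [f] approximate the
    block of [g] containing [x], yet their coordinate at [x] is orthogonal to [g x], so [|g x|^2] is
    at most the approximation error. *)
Lemma cyclic_of_blocks_span_dense N Lam f : (1 <= N)%nat -> lacunary Lam ->
  in_H2_Lambda X Lam f -> completely_rel_compact X f ->
  (forall m, blocks_span_dense X N m f) -> cyclic_bshiftN X N f.
Proof.
  intros HN HLam [Hf Hsupp] Hcrc Hdense g0 Hg0 eps He.
  apply in_H2_sqsum in Hf; apply in_H2_sqsum in Hg0.
  destruct (orbit_projection N f g0 Hf Hg0) as [g [Hg [Ho1 [Ho2 Happrox]]]].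
  apply Happrox; auto.
  destruct (orbit_orthogonal_tail X N Lam f g HN HLam Hsupp Hf Hg Hcrc Ho1 Ho2) as [M HM].
  intros x; apply Rle_antisym; [|apply (sip_pos (hreal X))].
  apply le_epsilon; intros r Hr; rewrite Rplus_0_l.
  destruct (Hdense M (fun i => g (N * (x / N) + i)%nat) r Hr) as [l [Hl Hlt]].
  apply Rlt_le, Rle_lt_trans with (2 := Hlt).
  pose proof (Nat.mod_upper_bound x N ltac:(lia)) as Hx.
  refine (Rle_trans _ _ _ _ (fsum_ge_term N _ (x mod N) (fun k => pow2_ge_0 _) Hx)).
  rewrite <- Nat.div_mod by lia; rewrite hnorm_sqr.
  set (w := lincomb X l _).
  assert (Hw : rip X w (g x) = 0).
  { apply lincomb_orthogonal with M; auto; intros k Hk; apply HM; [nia|].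
    rewrite Nat.add_comm, Nat.mul_comm, Nat.Div0.mod_add, Nat.Div0.mod_mod; reflexivity. }
  rewrite rip_hsub, !rip_hsub_r, (sip_sym (hreal X) (g x) w), Hw.
  pose proof (sip_pos (hreal X) w); lra.
Qed.

End Cyclic.

Theorem mainTheorem9 (X : CHilbert) (N : nat) (Lam : nat -> Prop) (f : nat -> X) :
  separable X ->
  (1 <= N)%nat ->
  lacunary Lam ->
  in_H2_Lambda X Lam f ->
  completely_rel_compact X f ->
  (cyclic_bshiftN X N f <-> forall m : nat, blocks_span_dense X N m f).
Proof.
  intros _ HN HLam Hf Hcrc; split.
  - intros Hc m; now apply blocks_span_dense_of_cyclic.
  - now apply cyclic_of_blocks_span_dense with Lam.
Qed.
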